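(* Suppose that there exists $\xi>\max\{4(B+1),8\}$ such that $\sqrt N(\log N)^{\xi}=O(\theta_N)$ and $\theta_N=O(N)$, that $\{h_1,\dots,h_k\}$ is an orthonormal set of bounded functions in $L^2[0,1]$, and additionally that $N^{2/3}\ll\theta_N$ (that is, $N^{2/3}=o(\theta_N)$). Fix $1\le i\le k$ and let $\mathbf B=\mathbf B_N$ be the deterministic $k\times k$ matrix with entries $$\mathbf B(j,\ell)=\sqrt{\alpha_j\alpha_\ell}\,\theta\,e_j'e_\ell+\frac{\sqrt{\alpha_j\alpha_\ell}\;\mathbb E(e_j'W^2e_\ell)}{\theta\alpha_i^2},\qquad 1\le j,\ell\le k.$$ Then, as $N\to\infty$, $$\mathbb E(\lambda_i(A))=\lambda_i(\mathbf B)\left(1+O\left(\frac{N^2}{\theta^3}\right)\right),$$ where $\lambda_i(\mathbf B)$ is the $i$-th eigenvalue of $\mathbf B$.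
   Context: Model: fix an integer $k\ge1$, constants $\alpha_1>\alpha_2>\dots>\alpha_k>0$, a constant $B>0$, and a bounded Riemann-integrable function $f:[0,1]^2\to[0,\infty)$. For each $N$, $W=W_N$ is the $N\times N$ random symmetric matrix $W_N(j,\ell)=X_{j\wedge\ell,\,j\vee\ell}$, where $\{X_{j,\ell}:1\le j\le\ell\le N\}$ are independent (not necessarily identically distributed) random variables with mean $0$, variance $f(j/N,\ell/N)$, and $\mathbb E|X_{j,\ell}|^m\le m^{Bm}$ for all $m\ge1$. The vectors $e_1,\dots,e_k$ are deterministic unit vectors in $\mathbb R^N$ obtained by discretizing functions $h_1,\dots,h_k$ on $[0,1]$: the $\ell$-th entry of the column vector $e_i$ is $h_i(\ell/N)/\sqrt N$. (The orthonormality assumption on the $h_i$ is regarded as equivalent to asymptotic orthonormality of the $e_i$, that is, $e_i'e_j=\langle h_i,h_j\rangle_{L^2[0,1]}+o(1)$.) For a deterministic scalar $\theta=\theta_N>0$, which may grow with $N$, put $A=A_N=W_N+\theta_N\sum_{i=1}^k\alpha_i e_ie_i'$ (prime denotes transpose). $\lambda_1(M)\ge\lambda_2(M)\ge\cdots$ are the ordered eigenvalues of a symmetric matrix $M$. (The scalar $B$ in the moment bound and the matrix $\mathbf B$ are unrelated.) *)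

(* Defs.v *)
From HB Require Import structures.
From mathcomp Require Import all_boot all_order all_algebra.
From mathcomp Require Import all_classical all_reals all_analysis.

Set Implicit Arguments.
Unset Strict Implicit.
Unset Printing Implicit Defensive.

Import Order.TTheory GRing.Theory Num.Theory.
Import numFieldNormedType.Exports.

Local Open Scope classical_set_scope.
Local Open Scope ring_scope.

(* R with the sigma-algebra of Lebesgue-measurable (not just Borel) sets, on
   which completed_lebesgue_measure is defined. *)
Definition lebesgue_type (R : realType) :=
  caratheodory_type ((wlength (@idfun R))^*)%mu.

Definition L2inner (R : realType) (g h : R -> R) : R :=
  \int[@completed_lebesgue_measure R]_(x in `[0, 1]) (g x * h x).

(* Darboux integrability on [0,1]^2. A partition of [0,1] is 0 :: s with
   itv_partition 0 1 s. *)
Section Riemann2.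
Variable R : realType.
Implicit Types (f : R -> R -> R) (s t : seq R).

Definition cell s (i : nat) : set R :=
  `[nth 1 (0 :: s) i, nth 1 (0 :: s) i.+1].

Definition cell_length s (i : nat) : R :=
  nth 1 (0 :: s) i.+1 - nth 1 (0 :: s) i.

Definition values f (A B : set R) : set R :=
  [set f p.1 p.2 | p in A `*` B].

Definition upper_sum f s t : R :=
  \sum_(i < size s) \sum_(j < size t)
    sup (values f (cell s i) (cell t j)) * (cell_length s i * cell_length t j).

Definition lower_sum f s t : R :=
  \sum_(i < size s) \sum_(j < size t)
    inf (values f (cell s i) (cell t j)) * (cell_length s i * cell_length t j).

Definition upper_integral f : R :=
  inf [set upper_sum f p.1 p.2 |
        p in [set p | itv_partition 0 1 p.1 /\ itv_partition 0 1 p.2]].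

Definition lower_integral f : R :=
  sup [set lower_sum f p.1 p.2 |
        p in [set p | itv_partition 0 1 p.1 /\ itv_partition 0 1 p.2]].

Definition Riemann_integrable2 f := lower_integral f = upper_integral f.

End Riemann2.

Definition mutually_independent d (T : measurableType d) (R : realType)
    (P : probability T R) (I : finType) (D : {set I})
    (X : I -> {RV P >-> R}) :=
  forall (J : {set I}) (A : I -> set R),
    J \subset D -> (forall i, measurable (A i)) ->
    (P (\bigcap_(i in [set` J]) (X i @^-1` A i))
     = \prod_(i in J) P (X i @^-1` A i))%E.

(* The eigenvalues of M with multiplicity, in nonincreasing order; such a list
   is unique, and it exists when M is symmetric (otherwise it may be junk). *)
Definition eigenvalues (R : realType) (n : nat) (M : 'M[R]_n) : seq R :=
  xget [::] [set s : seq R | sorted >=%R s /\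
                             char_poly M = \prod_(x <- s) ('X - x%:P)].

(* Indices start at 0: nth_eigenvalue M 0 is the largest eigenvalue. *)
Definition nth_eigenvalue (R : realType) (n : nat) (M : 'M[R]_n) (i : nat) : R :=
  nth 0 (eigenvalues M) i.

Definition dotv (R : realType) (n : nat) (u v : 'cV[R]_n) : R := (u^T *m v) 0 0.

(* In the definitions below l : 'I_N stands for the index l.+1 of {1, ..., N}. *)
Definition grid (R : realType) (N : nat) (l : 'I_N) : R := l.+1%:R / N%:R.

Definition discretize (R : realType) (N : nat) (g : R -> R) : 'cV[R]_N :=
  \col_(l < N) (g (grid R l) / Num.sqrt N%:R).

Definition Wigner (R : realType) (N : nat) (X : 'I_N -> 'I_N -> R) : 'M[R]_N :=
  \matrix_(j < N, l < N) if (j <= l)%N then X j l else X l j.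

Definition spiked (R : realType) (k N : nat) (alpha : 'I_k -> R)
    (h : 'I_k -> R -> R) (theta : R) (W : 'M[R]_N) : 'M[R]_N :=
  W + theta *: \sum_(i < k)
        alpha i *: (discretize N (h i) *m (discretize N (h i))^T).

Definition Bmatrix (R : realType) (k N : nat) d (T : measurableType d)
    (P : probability T R) (alpha : 'I_k -> R) (h : 'I_k -> R -> R)
    (theta : R) (W : T -> 'M[R]_N) (i : 'I_k) : 'M[R]_k :=
  \matrix_(j < k, l < k)
    (Num.sqrt (alpha j * alpha l) * theta
       * dotv (discretize N (h j)) (discretize N (h l))
     + Num.sqrt (alpha j * alpha l)
       * fine 'E_P[fun w => dotv (discretize N (h j))
                              (W w *m W w *m discretize N (h l))]%E
       / (theta * alpha i ^+ 2)).

(* Main.v *)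
(** Let [mu_1 >= ... >= mu_k] be the eigenvalues of the Gram matrix
    [G(j, l) = sqrt (alpha_j alpha_l) e_j'e_l]. Then
    [theta sum_j alpha_j e_j e_j' = theta sum_j mu_j v_j v_j'] with orthonormal
    [v_j], and [mu_j -> alpha_j]. Both [E (lambda_i A)] and [lambda_i B] are
    compared with [theta mu_i]; an error [O(N / theta)] is harmless, because
    [theta = O(N)] makes it [O(N^2 / theta^2)]. For [B] this is Weyl's
    inequality. For [A], Courant-Fischer applied to the span of [v_1 .. v_i]
    and to the complement of the span of [v_1 .. v_(i-1)] yields, for every
    symmetric [W],
    [|lambda_i A - theta mu_i - v_i'W v_i| <=
       2 |W v_i|^2 / g + 2 4^5 |W^3|_F^2 / g^5],
    where [g] is of order [theta]. Here [v_i'W v_i] is centred,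
    [E |W v_i|^2 = O(N)], and [E |W^3|_F^2 = O(N^4)], since a product of six
    entries of [W] has nonzero mean only if no edge occurs exactly once, which
    leaves at most four distinct indices. Finally
    [N^4 / theta^5 <= N^2 / theta^2] because [N^(2/3) = o(theta)]. *)

Require Import Defs.
From HB Require Import structures.
From mathcomp Require Import all_boot all_order all_algebra.
From mathcomp Require Import perm fingroup complex spectral.
From mathcomp Require Import ring lra zify.
From mathcomp Require Import all_classical all_reals all_analysis.
From mathcomp Require Import measurable_realfun.

Set Implicit Arguments.
Unset Strict Implicit.
Unset Printing Implicit Defensive.

Import Order.TTheory GRing.Theory Num.Theory.
Import numFieldNormedType.Exports.

Local Open Scope classical_set_scope.
Local Open Scope ring_scope.

(** * The spectral theorem for real symmetric matrices *)

(** The perturbation bound holds for every realization of [W], so no event of large operator norm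
    has to be excluded and moments alone control its mean. The third power of [W] is dictated by the
    growth of theta. Using |W^p|_F^2 instead would cost a term of order N^(p+1) / theta^(2p-1),
    which is O(N^2 / theta^2) exactly when N^(p-1) = O(theta^(2p-3)). For p = 1 this fails, for p =
    2 it asks for N = O(theta), and for p = 3 it asks for N^(2/3) = O(theta). The reference value is
    theta mu_i and not theta alpha_i, because e_j'e_l converges at an unspecified rate: the Gram
    matrix has to be kept exactly on both sides, so that its error cancels. The eigenvalue of A is
    squeezed between two polynomials in the entries of [W], which controls its mean without a study
    of its measurability. *)

Section RealSymmetric.
Variable R : rcfType.

(** Over the complex numbers the matrix is hermitian, hence unitarily diagonalizable with real
    eigenvalues; a real root of the characteristic polynomial descends along the embedding of
    [R]. *)
Lemma symmetric_eigenvalue n (S : 'M[R]_n.+1) :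
  S^T = S -> exists x, eigenvalue S x.
Proof.
move=> symS.
pose A := map_mx (real_complex R) S.
have Areal : A \is a mxOver Num.real.
  by apply/mxOverP => i j; rewrite !mxE complex_real.
have Asym : A \is symmetricmx.
  apply/is_hermitianmxP; rewrite expr0 scale1r map_mx_id//.
  by rewrite /A -[in LHS]symS map_trmx.
have Aherm := realsym_hermsym Asym Areal.
pose a := spectral_diag A 0 0.
have areal : a \is Num.real.
  by move/mxOverP: (hermitian_spectral_diag_real Aherm); apply.
have Aa : eigenvalue A a.
  apply/eigenvalueP; exists (row 0 (spectralmx A)).
    have PA : spectralmx A *m A = diag_mx (spectral_diag A) *m spectralmx A.
      have /orthomx_spectralP {2}-> := hermitian_normalmx Aherm.
      by rewrite !mulmxA mulmxV ?mul1mx// spectral_unit.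
    by rewrite -row_mul PA row_mul row_diag_mx -scalemxAl -rowE.
  apply/negP => /eqP r0.
  have := spectral_unitarymx A; move/unitarymxP/(congr1 (row 0)).
  rewrite row_mul r0 mul0mx => /rowP/(_ 0); rewrite !mxE eqxx => /esym/eqP.
  by rewrite oner_eq0.
have /complex_realP[x ax] := areal.
exists x; move: Aa; rewrite ax !eigenvalue_root_char.
by rewrite -map_char_poly fmorph_root.
Qed.

Lemma dot_rvE n (u v : 'rV[R]_n) : (u *m v^T) 0 0 = \sum_i u 0 i * v 0 i.
Proof. by rewrite !mxE; apply: eq_bigr => i _; rewrite !mxE. Qed.

Lemma dot_rv_ge0 n (u : 'rV[R]_n) : 0 <= (u *m u^T) 0 0.
Proof. by rewrite dot_rvE sumr_ge0// => i _; rewrite -expr2 sqr_ge0. Qed.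

Lemma dot_rv_eq0 n (u : 'rV[R]_n) : ((u *m u^T) 0 0 == 0) = (u == 0).
Proof.
apply/eqP/eqP => [|->]; last by rewrite mul0mx mxE.
rewrite dot_rvE => /eqP; rewrite psumr_eq0; last first.
  by move=> i _; rewrite -expr2 sqr_ge0.
move=> /allP u0; apply/rowP => i; rewrite mxE.
by have := u0 i (mem_index_enum i); rewrite -expr2 sqrf_eq0 => /eqP.
Qed.

Lemma dot_rv_gt0 n (u : 'rV[R]_n) : u != 0 -> 0 < (u *m u^T) 0 0.
Proof. by move=> u0; rewrite lt_def dot_rv_eq0 u0 dot_rv_ge0. Qed.

(* H = 1 - 2 w w^T / |w|^2 with w = e - v reflects e to v. *)
Lemma householder n (e v : 'rV[R]_n) :
  (e *m e^T) 0 0 = 1 -> (v *m v^T) 0 0 = 1 ->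
  exists H : 'M[R]_n, [/\ H^T = H, H *m H = 1%:M & e *m H = v].
Proof.
move=> e1 v1; have [->|ev] := eqVneq e v.
  by exists 1%:M; rewrite trmx1 mulmx1 mulmx1.
pose w := e - v; pose q := (w *m w^T) 0 0.
have w0 : w != 0 by rewrite subr_eq0.
have q0 : q != 0 by rewrite dot_rv_eq0.
pose H := 1%:M - (2 / q) *: (w^T *m w).
have wwE : w *m w^T = q%:M by rewrite [LHS]mx11_scalar.
have veE : (v *m e^T) 0 0 = (e *m v^T) 0 0.
  by rewrite !dot_rvE; apply: eq_bigr => i _; exact: mulrC.
have ewE : e *m w^T = (q / 2)%:M.
  rewrite [LHS]mx11_scalar; congr (_%:M).
  have -> : q = 2 * (e *m w^T) 0 0.
    have subE (A B : 'M[R]_1) : (A - B) 0 0 = A 0 0 - B 0 0 by rewrite !mxE.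
    by rewrite /q /w linearB/= mulmxBl !mulmxBr !subE e1 v1 veE; ring.
  by field.
exists H; split.
- by rewrite /H linearB/= trmx1 linearZ/= trmx_mul trmxK.
- pose K := (2 / q) *: (w^T *m w).
  have KK : K *m K = K + K.
    rewrite /K -!scalemxAl -!scalemxAr !mulmxA.
    rewrite -(mulmxA _ w) wwE mul_mx_scalar -scalemxAl !scalerA -scalerDl.
    by congr (_ *: _); field.
  rewrite /H -/K mulmxBl mul1mx mulmxBr mulmx1 KK.
  by rewrite opprB addrK subrK.
- rewrite /H mulmxBr mulmx1 -scalemxAr mulmxA ewE mul_scalar_mx scalerA.
  have -> : 2 / q * (q / 2) = 1 by field.
  by rewrite scale1r /w opprB addrCA subrr addr0.
Qed.

(** Deflation: a reflection carrying the first basis vector to a unit eigenvector conjugates [S] to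
    a block diagonal matrix, whose lower block is symmetric and smaller. *)
Lemma symmetric_spectral_unsorted n (S : 'M[R]_n) : S^T = S ->
  exists (U : 'M[R]_n) (d : 'rV[R]_n),
    U *m U^T = 1%:M /\ S = U^T *m diag_mx d *m U.
Proof.
elim: n S => [|n IH] S symS.
  by exists 1%:M, 0; split; apply/matrixP => -[].
have [x /eigenvalueP[u uS u0]] := symmetric_eigenvalue symS.
pose c := Num.sqrt ((u *m u^T) 0 0).
have c0 : c != 0 by rewrite gt_eqF// sqrtr_gt0 dot_rv_gt0.
have c2 : c ^+ 2 = (u *m u^T) 0 0 by rewrite sqr_sqrtr// dot_rv_ge0.
pose v := c^-1 *: u.
have vS : v *m S = x *: v by rewrite -scalemxAl uS !scalerA mulrC.
have v1 : (v *m v^T) 0 0 = 1.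
  rewrite /v linearZ/= -scalemxAl -scalemxAr scalerA mxE -c2.
  by field.
pose e : 'rV[R]_(1 + n) := row_mx 1%:M 0.
have e1 : (e *m e^T) 0 0 = 1.
  by rewrite /e tr_row_mx mul_row_col trmx1 mulmx1 mul0mx addr0 mxE eqxx.
have [H [symH HH eH]] := householder e1 v1.
pose S1 : 'M[R]_(1 + n) := H *m S *m H.
have symS1 : S1^T = S1 by rewrite /S1 !trmx_mul symS symH mulmxA.
have eS1 : e *m S1 = x *: e.
  by rewrite /S1 !mulmxA eH vS -scalemxAl -eH -mulmxA HH mulmx1.
have eblock (M : 'M[R]_(1 + n)) : e *m M = usubmx M.
  by rewrite -{1}[M]vsubmxK /e mul_row_col mul1mx mul0mx addr0.
have ulS1 : ulsubmx S1 = x%:M.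
  rewrite /ulsubmx -eblock eS1 linearZ/= /e row_mxKl; apply/matrixP => i j.
  by rewrite !mxE !ord1 eqxx mulr1.
have urS1 : ursubmx S1 = 0.
  by rewrite /ursubmx -eblock eS1 linearZ/= /e row_mxKr scaler0.
have dlS1 : dlsubmx S1 = 0 by rewrite -symS1 -trmx_ursub urS1 trmx0.
have [|U [d [UU drE]]] := IH (drsubmx S1).
  by rewrite -{2}symS1 trmx_drsub.
have S1E : S1 = block_mx x%:M 0 0 (U^T *m diag_mx d *m U).
  by rewrite -[LHS]submxK ulS1 urS1 dlS1 drE.
pose U1 : 'M[R]_(1 + n) := block_mx 1%:M 0 0 U.
have U1T : U1^T = block_mx 1%:M 0 0 U^T.
  by rewrite /U1 tr_block_mx !trmx0 trmx1.
have U1U1 : U1 *m U1^T = 1%:M.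
  rewrite U1T /U1 mulmx_block !mul0mx !mulmx0 !mul1mx !addr0 !add0r UU.
  by rewrite -scalar_mx_block.
exists (U1 *m H), (row_mx x%:M d); split.
  by rewrite trmx_mul symH mulmxA -(mulmxA U1) HH mulmx1 U1U1.
have S1D : S1 = U1^T *m diag_mx (row_mx x%:M d) *m U1.
  rewrite diag_mx_row S1E U1T /U1 !mulmx_block !mul0mx !mulmx0 !mul1mx !mulmx1.
  rewrite !addr0 !add0r; congr (block_mx _ _ _ _); rewrite ?mul0mx//.
  by apply/matrixP => i j; rewrite !mxE !ord1 eqxx.
have SE : S = H *m S1 *m H by rewrite /S1 !mulmxA HH mul1mx -mulmxA HH mulmx1.
by rewrite SE S1D trmx_mul symH !mulmxA.
Qed.

Lemma symmetric_spectral n (S : 'M[R]_n) : S^T = S ->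
  exists (U : 'M[R]_n) (d : 'rV[R]_n),
    [/\ U *m U^T = 1%:M, S = U^T *m diag_mx d *m U &
        sorted >=%R [seq d 0 i | i <- enum 'I_n]].
Proof.
move=> /symmetric_spectral_unsorted [U [d [UU SE]]].
pose t := [tuple d 0 i | i < n].
have /tuple_permP[p pE] : perm_eq (sort >=%R t) t by rewrite perm_sort.
exists (row_perm p U), (col_perm p d); split.
- rewrite row_permE trmx_mul mulmxA -(mulmxA _ U) UU mulmx1 tr_perm_mx.
  by rewrite -perm_mxM mulgV perm_mx1.
- rewrite SE row_permE trmx_mul tr_perm_mx !mulmxA; congr (_ *m U).
  rewrite -!mulmxA; congr (U^T *m _).
  have -> : perm_mx p = perm_mx (p^-1)^-1 :> 'M[R]_n by rewrite invgK.
  rewrite -col_permE -row_permE; apply/matrixP => i j.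
  by rewrite !mxE permKV (inj_eq perm_inj).
- suff -> : [seq col_perm p d 0 i | i <- enum 'I_n] = sort >=%R t.
    by apply: sort_sorted => x y; rewrite le_total.
  by rewrite pE /=; apply: eq_map => i /=; rewrite tnth_mktuple mxE.
Qed.

(** The dimension count behind both halves of Courant-Fischer: [m] linear conditions on [m.+1]
    coordinates have a nonzero solution. *)
Lemma wide_kernel m (K : 'M[R]_(m.+1, m)) :
  exists2 x : 'rV[R]_m.+1, x != 0 & x *m K = 0.
Proof.
have : kermx K != 0.
  by rewrite -mxrank_eq0 mxrank_ker subn_eq0 -ltnNge ltnS rank_leq_col.
by move=> /rowV0Pn[x /sub_kermxP xK x0]; exists x.
Qed.

End RealSymmetric.

(** * The Courant-Fischer principle *)

Section CourantFischer.
Variable R : realType.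

Lemma char_poly_orthogonal n (U : 'M[R]_n) (d : 'rV[R]_n) :
  U *m U^T = 1%:M ->
  char_poly (U^T *m diag_mx d *m U) = \prod_i ('X - (d 0 i)%:P).
Proof.
move=> UU; have UTU := mulmx1C UU.
have -> : char_poly (U^T *m diag_mx d *m U) = char_poly (diag_mx d).
  rewrite /char_poly /char_poly_mx.
  have -> : 'X%:M - map_mx polyC (U^T *m diag_mx d *m U) =
      map_mx polyC U^T *m ('X%:M - map_mx polyC (diag_mx d)) *m map_mx polyC U.
    rewrite mulmxBr mulmxBl mul_mx_scalar -scalemxAl -map_mxM UTU map_mx1.
    by rewrite scalemx1 !map_mxM.
  rewrite !det_mulmx mulrAC -det_mulmx -map_mxM UTU map_mx1 det1.
  by rewrite mul1r.
rewrite char_poly_trig ?diag_mx_is_trig//.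
by apply: eq_bigr => i _; rewrite mxE eqxx mulr1n.
Qed.

(** The choice made by [xget] is forced: the linear factors determine the list up to permutation,
    and sorting fixes the order. *)
Lemma eigenvaluesE n (U : 'M[R]_n) (d : 'rV[R]_n) :
  U *m U^T = 1%:M -> sorted >=%R [seq d 0 i | i <- enum 'I_n] ->
  eigenvalues (U^T *m diag_mx d *m U) = [seq d 0 i | i <- enum 'I_n].
Proof.
move=> UU ds; set S := _ *m _ *m _; set t := [seq _ | _ <- _].
have St : char_poly S = \prod_(x <- t) ('X - x%:P).
  by rewrite char_poly_orthogonal// big_map big_enum.
have [es eE] : sorted >=%R (eigenvalues S) /\
    char_poly S = \prod_(x <- eigenvalues S) ('X - x%:P).
  by rewrite /eigenvalues; case: xgetP => // /(_ t); case.
apply: (@sorted_eq _ (>=%R : rel R)) => //.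
- by move=> x y z xy yz; exact: le_trans yz xy.
- by move=> x y; rewrite andbC => /le_anti.
- by apply: prod_XsubC_eq; rewrite -eE St.
Qed.

(** Monotonicity is confined to [j < n], because [nth_eigenvalue] takes the default value [0] past
    the end of the spectrum. *)
Lemma spectral_nth_eigenvalue n (S : 'M[R]_n) : S^T = S ->
  exists U : 'M[R]_n, [/\ U *m U^T = 1%:M,
    S = U^T *m diag_mx (\row_i nth_eigenvalue S i) *m U &
    forall i j, (i <= j < n)%N -> nth_eigenvalue S j <= nth_eigenvalue S i].
Proof.
move=> /symmetric_spectral [U [d [UU SE ds]]].
have eS : eigenvalues S = [seq d 0 i | i <- enum 'I_n].
  by rewrite {1}SE eigenvaluesE.
have nS (i : 'I_n) : nth_eigenvalue S i = d 0 i.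
  by rewrite /nth_eigenvalue eS (nth_map i) ?size_enum_ord// nth_ord_enum.
exists U; split => //.
  by rewrite [LHS]SE; congr (_ *m diag_mx _ *m _); apply/rowP => i; rewrite mxE nS.
move=> i j /andP[ij jn]; rewrite /nth_eigenvalue eS.
have trge : transitive (>=%R : rel R).
  by move=> x y z xy yz; exact: le_trans yz xy.
apply: (@sorted_leq_nth _ _ trge lexx 0 _ ds i j) => //.
  by rewrite inE size_map size_enum_ord (leq_ltn_trans ij).
by rewrite inE size_map size_enum_ord.
Qed.

Lemma orthonormal_quad k n (S : 'M[R]_n) (U : 'M[R]_(k, n)) (d : 'rV[R]_k)
    (u : 'rV[R]_n) :
  S = U^T *m diag_mx d *m U ->
  (u *m S *m u^T) 0 0 = \sum_j d 0 j * (u *m U^T) 0 j ^+ 2.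
Proof.
move=> ->.
have -> : u *m (U^T *m diag_mx d *m U) *m u^T =
    (u *m U^T *m diag_mx d) *m (u *m U^T)^T.
  by rewrite trmx_mul trmxK !mulmxA.
rewrite dot_rvE; apply: eq_bigr => j _.
by rewrite mul_mx_diag [X in X * _]mxE; ring.
Qed.

Lemma orthonormal_dot m n (U : 'M[R]_(m, n)) (x : 'rV[R]_m) :
  U *m U^T = 1%:M -> (x *m U *m (x *m U)^T) 0 0 = (x *m x^T) 0 0.
Proof. by move=> UU; rewrite trmx_mul mulmxA -(mulmxA x) UU mulmx1. Qed.

(** Max-min half: some nonzero vector in the span of the [i.+1] rows of [V] is orthogonal to the top
    [i] eigenvectors, and there the form is at most [nth_eigenvalue S i] times the squared norm. *)
Lemma nth_eigenvalue_ge n (S : 'M[R]_n) i (V : 'M[R]_(i.+1, n)) c :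
  S^T = S -> (i < n)%N -> V *m V^T = 1%:M ->
  (forall x : 'rV[R]_i.+1,
    c * (x *m x^T) 0 0 <= (x *m V *m S *m (x *m V)^T) 0 0) ->
  c <= nth_eigenvalue S i.
Proof.
move=> /spectral_nth_eigenvalue [U [UU SE le_eig]] lt_in VV cS.
pose f := widen_ord (ltnW lt_in).
have [x x0 xK] := wide_kernel (colsub f (V *m U^T)).
have xx := dot_rv_gt0 x0.
rewrite -(ler_pM2r xx); apply: (le_trans (cS x)).
set y := x *m V *m U^T.
have y0 (j : 'I_n) : (j < i)%N -> y 0 j = 0.
  move=> ji; have -> : j = f (Ordinal ji) by exact: val_inj.
  by have /rowP/(_ (Ordinal ji)) := xK; rewrite mulmx_colsub mulmxA !mxE.
have yy : (x *m x^T) 0 0 = \sum_j y 0 j ^+ 2.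
  rewrite -(orthonormal_dot x VV) -(@orthonormal_dot _ _ U^T (x *m V)).
    by rewrite dot_rvE; apply: eq_bigr => j _; rewrite expr2.
  by rewrite trmxK (mulmx1C UU).
rewrite (orthonormal_quad _ SE) yy mulr_sumr; apply: ler_sum => j _.
rewrite -/y mxE; have [ji|ij] := ltnP j i; first by rewrite y0// expr0n !mulr0.
by rewrite ler_wpM2r ?sqr_ge0// le_eig// ij ltn_ord.
Qed.

Lemma rayleigh_top n (S U : 'M[R]_n) i (lt_in : (i < n)%N)
    (x : 'rV[R]_i.+1) (u := x *m rowsub (widen_ord lt_in) U) :
  U *m U^T = 1%:M -> S = U^T *m diag_mx (\row_i nth_eigenvalue S i) *m U ->
  (forall i j, (i <= j < n)%N -> nth_eigenvalue S j <= nth_eigenvalue S i) ->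
  (u *m u^T) 0 0 = (x *m x^T) 0 0 /\
  nth_eigenvalue S i * (u *m u^T) 0 0 <= (u *m S *m u^T) 0 0.
Proof.
move=> UU SE le_eig; rewrite /u {u}; set f := widen_ord lt_in.
set u := x *m rowsub f U; split.
  apply: orthonormal_dot; apply/matrixP => a b.
  transitivity ((U *m U^T) (f a) (f b)).
    by rewrite !mxE; apply: eq_bigr => c _; rewrite !mxE.
  by rewrite UU !mxE.
have -> : (u *m u^T) 0 0 = \sum_j (u *m U^T) 0 j ^+ 2.
  rewrite -(@orthonormal_dot _ _ U^T u); last by rewrite trmxK (mulmx1C UU).
  by rewrite dot_rvE; apply: eq_bigr => j _; rewrite expr2.
rewrite (orthonormal_quad _ SE) mulr_sumr; apply: ler_sum => j _.
rewrite mxE; have [ji|ij] := leqP j i.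
  by rewrite ler_wpM2r ?sqr_ge0// le_eig// ji lt_in.
suff -> : (u *m U^T) 0 j = 0 by rewrite expr0n !mulr0.
rewrite /u -mulmxA mul_rowsub_mx UU mxE big1// => a _; rewrite !mxE.
have [/(congr1 val)/= aj|] := eqVneq (f a) j; last by rewrite mulr0.
by move: ij; rewrite -aj ltnNge -ltnS ltn_ord.
Qed.

(** Min-max half: the [i] conditions given by [V] leave a nonzero vector in the span of the top
    [i.+1] eigenvectors. *)
Lemma nth_eigenvalue_le n (S : 'M[R]_n) i (V : 'M[R]_(i, n)) c :
  S^T = S -> (i < n)%N ->
  (forall u : 'rV[R]_n, u *m V^T = 0 ->
    (u *m S *m u^T) 0 0 <= c * (u *m u^T) 0 0) ->
  nth_eigenvalue S i <= c.
Proof.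
move=> /spectral_nth_eigenvalue [U [UU SE le_eig]] lt_in cS.
have [x x0 xK] := wide_kernel (rowsub (widen_ord lt_in) U *m V^T).
have [uu Su] := rayleigh_top lt_in x UU SE le_eig.
have xx := dot_rv_gt0 x0.
rewrite -(ler_pM2r xx) -uu; apply: le_trans Su (cS _ _).
by rewrite -mulmxA.
Qed.

(** One-sided Weyl inequality: the top [i.+1] eigenvectors of [S] serve as test space for [S']. *)
Lemma nth_eigenvalue_dist n (S S' : 'M[R]_n) i e : S^T = S -> S'^T = S' ->
  (i < n)%N ->
  (forall u : 'rV[R]_n, (u *m S *m u^T) 0 0 <=
     (u *m S' *m u^T) 0 0 + e * (u *m u^T) 0 0) ->
  nth_eigenvalue S i <= nth_eigenvalue S' i + e.
Proof.
move=> symS symS' lt_in SS'; rewrite -lerBlDr.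
have [U [UU SE le_eig]] := spectral_nth_eigenvalue symS.
apply: (@nth_eigenvalue_ge _ _ _ (rowsub (widen_ord lt_in) U)) => //.
  apply/matrixP => a b.
  transitivity ((U *m U^T) (widen_ord lt_in a) (widen_ord lt_in b)).
    by rewrite !mxE; apply: eq_bigr => c _; rewrite !mxE.
  by rewrite UU !mxE.
move=> x; have [uu Su] := rayleigh_top lt_in x UU SE le_eig.
by rewrite mulrBl lerBlDr -uu; apply: le_trans Su (SS' _).
Qed.

End CourantFischer.

(** * Perturbation of an isolated eigenvalue *)

Section Perturbation.
Variable R : realType.

Lemma cauchy_schwarz n (u v : 'rV[R]_n) :
  (u *m v^T) 0 0 ^+ 2 <= (u *m u^T) 0 0 * (v *m v^T) 0 0.
Proof.
set a := (u *m u^T) 0 0; set b := (u *m v^T) 0 0; set c := (v *m v^T) 0 0.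
have [v0|v0] := eqVneq v 0.
  by rewrite /b /c v0 trmx0 !mulmx0 !mxE expr0n mulr0.
have c0 : 0 < c by exact: dot_rv_gt0.
have : 0 <= c * (a * c - b ^+ 2).
  have -> : c * (a * c - b ^+ 2) =
      ((c *: u - b *: v) *m (c *: u - b *: v)^T) 0 0.
    have bE : (v *m u^T) 0 0 = b.
      by rewrite /b !dot_rvE; apply: eq_bigr => j _; exact: mulrC.
    rewrite [(_ - _)^T]linearB/= ![(_ *: _)^T]linearZ/= mulmxBl !mulmxBr.
    rewrite -!scalemxAl -!scalemxAr.
    have subE (A B : 'M[R]_1) : (A - B) 0 0 = A 0 0 - B 0 0 by rewrite !mxE.
    have sclE t (A : 'M[R]_1) : (t *: A) 0 0 = t * A 0 0 by rewrite !mxE.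
    by rewrite !subE !sclE bE -/a -/b -/c; ring.
  exact: dot_rv_ge0.
by rewrite pmulr_rge0// subr_ge0.
Qed.

Definition rvnorm n (u : 'rV[R]_n) := Num.sqrt ((u *m u^T) 0 0).

Lemma rvnorm_ge0 n (u : 'rV[R]_n) : 0 <= rvnorm u.
Proof. exact: sqrtr_ge0. Qed.

Lemma sqr_rvnorm n (u : 'rV[R]_n) : rvnorm u ^+ 2 = (u *m u^T) 0 0.
Proof. by rewrite sqr_sqrtr// dot_rv_ge0. Qed.

Lemma normr_dot_le n (u v : 'rV[R]_n) :
  `|(u *m v^T) 0 0| <= rvnorm u * rvnorm v.
Proof.
rewrite -ler_sqr ?nnegrE ?mulr_ge0 ?rvnorm_ge0//.
by rewrite real_normK ?num_real// exprMn !sqr_rvnorm cauchy_schwarz.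
Qed.

Lemma frobenius_bound m n (u : 'rV[R]_m) (A : 'M[R]_(m, n)) :
  ((u *m A) *m (u *m A)^T) 0 0 <=
  (u *m u^T) 0 0 * \sum_a \sum_b A a b ^+ 2.
Proof.
rewrite dot_rvE exchange_big mulr_sumr; apply: ler_sum => b _ /=.
have -> : (u *m A) 0 b = (u *m ((col b A)^T)^T) 0 0.
  by rewrite trmxK !mxE; apply: eq_bigr => a _; rewrite !mxE.
rewrite -expr2; apply: le_trans (cauchy_schwarz _ _) _.
have -> // : ((col b A)^T *m (col b A)^T^T) 0 0 = \sum_a A a b ^+ 2.
by rewrite dot_rvE; apply: eq_bigr => a _; rewrite !mxE expr2.
Qed.

(** For symmetric [W] this is the trace of W^6: a polynomial in the entries that dominates the sixth
    power of the operator norm. *)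
Definition cube_frobenius n (W : 'M[R]_n) : R :=
  \sum_a \sum_b (W *m W *m W) a b ^+ 2.

Lemma cube_frobenius_ge0 n (W : 'M[R]_n) : 0 <= cube_frobenius W.
Proof. by do 2 (apply: sumr_ge0 => ? _); exact: sqr_ge0. Qed.

(** Symmetry moves one factor [W] across the dot product, so the norms [p0], ..., [p3] of w, wW,
    wW^2, wW^3 are log-convex. Hence p1^3 <= p0^2 p3, and only [p3] is estimated by the Frobenius
    norm. *)
Lemma rvnorm_mul_pow6 n (W : 'M[R]_n) (w : 'rV[R]_n) : W^T = W ->
  rvnorm (w *m W) ^+ 6 <= cube_frobenius W * rvnorm w ^+ 6.
Proof.
move=> symW; set Q := cube_frobenius W.
pose p0 := rvnorm w; pose p1 := rvnorm (w *m W).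
pose p2 := rvnorm (w *m W *m W); pose p3 := rvnorm (w *m W *m W *m W).
have [p00 p10 p20 p30] : [/\ 0 <= p0, 0 <= p1, 0 <= p2 & 0 <= p3].
  by split; exact: rvnorm_ge0.
have Q0 : 0 <= Q := cube_frobenius_ge0 W.
have p1p1 : p1 ^+ 2 <= p2 * p0.
  rewrite sqr_rvnorm trmx_mul symW mulmxA; apply: le_trans (ler_norm _) _.
  exact: normr_dot_le.
have p2p2 : p2 ^+ 2 <= p3 * p1.
  rewrite sqr_rvnorm [in X in X <= _]trmx_mul symW mulmxA.
  apply: le_trans (ler_norm _) _; exact: normr_dot_le.
have p3p3 : p3 ^+ 2 <= p0 ^+ 2 * Q.
  rewrite !sqr_rvnorm; have -> : w *m W *m W *m W = w *m (W *m W *m W).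
    by rewrite !mulmxA.
  exact: frobenius_bound.
rewrite -/p0 -/p1.
have [p1eq0|p1neq0] := eqVneq p1 0.
  by rewrite p1eq0 expr0n/= mulr_ge0// exprn_ge0.
have p1gt0 : 0 < p1 by rewrite lt_def p1neq0.
have h3 : p1 ^+ 3 <= p0 ^+ 2 * p3.
  rewrite -(ler_pM2r p1gt0).
  have -> : p1 ^+ 3 * p1 = (p1 ^+ 2) ^+ 2 by ring.
  apply: (@le_trans _ _ ((p2 * p0) ^+ 2)).
    by rewrite ler_sqr ?nnegrE ?mulr_ge0 ?exprn_ge0.
  rewrite exprMn mulrC -(mulrA (p0 ^+ 2)).
  by apply: ler_wpM2l => //; exact: exprn_ge0.
have -> : p1 ^+ 6 = (p1 ^+ 3) ^+ 2 by ring.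
apply: (@le_trans _ _ ((p0 ^+ 2 * p3) ^+ 2)).
  by rewrite ler_sqr ?nnegrE ?mulr_ge0 ?exprn_ge0.
rewrite exprMn.
have -> : Q * p0 ^+ 6 = (p0 ^+ 2) ^+ 2 * (p0 ^+ 2 * Q) by ring.
by apply: ler_wpM2l => //; rewrite exprn_ge0// exprn_ge0.
Qed.

(* x <= c + x^6 / c^5 with c = g / 4, for x = |w W| / |w|. *)
Lemma rvnorm_mul_le n (W : 'M[R]_n) (w : 'rV[R]_n) g : W^T = W -> 0 < g ->
  rvnorm (w *m W) <=
    (g / 4 + 4 ^+ 5 * cube_frobenius W / g ^+ 5) * rvnorm w.
Proof.
move=> symW g0; have := rvnorm_mul_pow6 w symW.
have Q0 := cube_frobenius_ge0 W.
move: (cube_frobenius W) Q0 => Q Q0.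
have := rvnorm_ge0 w; have := rvnorm_ge0 (w *m W).
move: (rvnorm w) (rvnorm (w *m W)) => p0 p1 p1_ge0 p0_ge0 p6.
have c0 : 0 < g / 4 by rewrite divr_gt0.
have -> : 4 ^+ 5 * Q / g ^+ 5 = Q / (g / 4) ^+ 5 by field; rewrite gt_eqF.
move: (g / 4) c0 => c c0.
have Qc : 0 <= Q / c ^+ 5 by rewrite divr_ge0// exprn_ge0// ltW.
rewrite mulrDl; have [p1c|/ltW p1c] := leP p1 (c * p0).
  by rewrite (le_trans p1c)// lerDl mulr_ge0.
have [p0eq0|p0neq0] := eqVneq p0 0.
  move: p6; rewrite p0eq0 expr0n !mulr0 addr0/= => p6.
  rewrite leNgt; apply/negP => p1gt0; move: p6.
  by rewrite leNgt exprn_gt0.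
have p0gt0 : 0 < p0 by rewrite lt_def p0neq0.
apply: (@le_trans _ _ (Q / c ^+ 5 * p0)); last first.
  by rewrite lerDr mulr_ge0// ltW.
have cp0 : 0 < (c * p0) ^+ 5 by rewrite exprn_gt0// mulr_gt0.
rewrite -(ler_pM2r cp0).
have -> : Q / c ^+ 5 * p0 * (c * p0) ^+ 5 = Q * p0 ^+ 6 by field; rewrite gt_eqF.
apply: le_trans p6; rewrite (exprS p1 5) ler_wpM2l//.
by rewrite lerXn2r ?nnegrE// mulr_ge0// ltW.
Qed.

Lemma bessel k n (V : 'M[R]_(k, n)) (u : 'rV[R]_n) : V *m V^T = 1%:M ->
  \sum_j (u *m V^T) 0 j ^+ 2 <= (u *m u^T) 0 0.
Proof.
move=> VV; pose w := u - u *m V^T *m V.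
have -> : \sum_j (u *m V^T) 0 j ^+ 2 = (u *m V^T *m (u *m V^T)^T) 0 0.
  by rewrite dot_rvE; apply: eq_bigr => j _; rewrite expr2.
rewrite -subr_ge0; have -> : (u *m u^T) 0 0 - (u *m V^T *m (u *m V^T)^T) 0 0 =
    (w *m w^T) 0 0; last exact: dot_rv_ge0.
have addE (A B : 'M[R]_1) : A 0 0 - B 0 0 = (A - B) 0 0 by rewrite !mxE.
rewrite addE /w linearB/= mulmxBl !mulmxBr !trmx_mul !trmxK !mulmxA.
by rewrite -(mulmxA _ V V^T) VV mulmx1 subrr subr0.
Qed.

(** Write u = y v + w with w orthogonal to v; the left side is then |2 y vWw' + wWw' - a |w|^2|.
    AM-GM bounds the cross term by (g/2)|w|^2 + (2/g)|vW|^2 y^2, and [rvnorm_mul_le] bounds each of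
    the other two by (g/4 + T)|w|^2. The share g/4 is chosen so that the total weight of |w|^2 =
    |u|^2 - y^2, apart from [T], is exactly g. *)
Lemma quad_decomposition n (W : 'M[R]_n) (u v : 'rV[R]_n) g
    (y := (u *m v^T) 0 0) (a := (v *m W *m v^T) 0 0)
    (E := 2 * (v *m W *m (v *m W)^T) 0 0 / g
          + 2 * (4 ^+ 5 * cube_frobenius W / g ^+ 5)) :
  W^T = W -> 0 < g -> (v *m v^T) 0 0 = 1 ->
  `|(u *m W *m u^T) 0 0 - a * (u *m u^T) 0 0| <=
    g * ((u *m u^T) 0 0 - y ^+ 2) + E * (u *m u^T) 0 0.
Proof.
move=> symW g0 v1.
have addE (A B : 'M[R]_1) : (A + B) 0 0 = A 0 0 + B 0 0 by rewrite !mxE.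
have sclE t (A : 'M[R]_1) : (t *: A) 0 0 = t * A 0 0 by rewrite !mxE.
pose w := u - y *: v.
have uE : u = y *: v + w by rewrite /w addrC subrK.
have vw : (v *m w^T) 0 0 = 0.
  have yE : (v *m u^T) 0 0 = y.
    by rewrite /y !dot_rvE; apply: eq_bigr => j _; exact: mulrC.
  rewrite /w linearB linearZ/= mulmxBr -scalemxAr -scaleN1r addE !sclE yE v1.
  by ring.
have wv : (w *m v^T) 0 0 = 0.
  by rewrite -vw !dot_rvE; apply: eq_bigr => j _; exact: mulrC.
have vWw : (v *m W *m w^T) 0 0 = (w *m W *m v^T) 0 0.

  have -> : w *m W *m v^T = (v *m W *m w^T)^T.
    by rewrite !trmx_mul trmxK symW mulmxA.
  by rewrite [in RHS]mxE.
clearbody w; set c := (v *m W *m w^T) 0 0 in vWw.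
pose s := rvnorm w; pose b := rvnorm (v *m W); pose q := (w *m W *m w^T) 0 0.
have uu : (u *m u^T) 0 0 = y ^+ 2 + s ^+ 2.
  rewrite {1 2}uE [(_ + _)^T]linearD/= [(_ *: _)^T]linearZ/= mulmxDl !mulmxDr.
  by rewrite -!scalemxAl -!scalemxAr !(addE, sclE) v1 vw wv -sqr_rvnorm -/s; ring.
have uWu : (u *m W *m u^T) 0 0 = y ^+ 2 * a + 2 * y * c + q.
  rewrite {1 2}uE [(_ + _)^T]linearD/= [(_ *: _)^T]linearZ/= !mulmxDl !mulmxDr.
  by rewrite -!scalemxAl -!scalemxAr !(addE, sclE) -/a -/c -/q -vWw; ring.
pose T := 4 ^+ 5 * cube_frobenius W / g ^+ 5.
have T0 : 0 <= T.
  apply: divr_ge0; last by rewrite exprn_ge0// ltW.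
  by rewrite mulr_ge0 ?cube_frobenius_ge0// exprn_ge0.
have s0 : 0 <= s := rvnorm_ge0 w.
have b0 : 0 <= b := rvnorm_ge0 (v *m W).
have nv : rvnorm v = 1 by rewrite /rvnorm v1 sqrtr1.
have aT : `|a| <= g / 4 + T.
  apply: le_trans (normr_dot_le _ _) _; rewrite nv mulr1.
  by have := rvnorm_mul_le v symW g0; rewrite nv mulr1.
have cb : `|c| <= b * s by exact: normr_dot_le.
have qT : `|q| <= (g / 4 + T) * s ^+ 2.
  apply: le_trans (normr_dot_le _ _) _; rewrite -/s expr2 mulrA.
  by apply: ler_wpM2r => //; exact: rvnorm_mul_le.
rewrite uu uWu /E -sqr_rvnorm -/b -/T.
have -> : y ^+ 2 * a + 2 * y * c + q - a * (y ^+ 2 + s ^+ 2) =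
    2 * y * c + (q - a * s ^+ 2) by ring.
apply: le_trans (ler_normD _ _) _.
have h1 : `|2 * y * c| <= g / 2 * s ^+ 2 + 2 * b ^+ 2 / g * y ^+ 2.
  rewrite !normrM (ger0_norm (ler0n R 2)).
  apply: (@le_trans _ _ (2 * `|y| * (b * s))).
    by apply: ler_wpM2l => //; rewrite mulr_ge0.
  rewrite -(ler_pM2l g0) -subr_ge0.
  have -> : g * (g / 2 * s ^+ 2 + 2 * b ^+ 2 / g * y ^+ 2) -
      g * (2 * `|y| * (b * s)) =
      (g * s - 2 * b * `|y|) ^+ 2 / 2 + 2 * b ^+ 2 * (y ^+ 2 - `|y| ^+ 2).
    by field; rewrite gt_eqF.
  by rewrite real_normK ?num_real// subrr mulr0 addr0 divr_ge0// sqr_ge0.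
have h2 : `|q - a * s ^+ 2| <= 2 * (g / 4 + T) * s ^+ 2.
  apply: le_trans (ler_normB _ _) _; rewrite normrM (ger0_norm (sqr_ge0 s)).
  have : `|a| * s ^+ 2 <= (g / 4 + T) * s ^+ 2.
    by apply: ler_wpM2r; rewrite ?sqr_ge0.
  by move: qT; move: (`|a| * _) => x; lra.
apply: le_trans (lerD h1 h2) _; rewrite -subr_ge0.
have -> : g * (y ^+ 2 + s ^+ 2 - y ^+ 2) +
    (2 * b ^+ 2 / g + 2 * T) * (y ^+ 2 + s ^+ 2) -
    (g / 2 * s ^+ 2 + 2 * b ^+ 2 / g * y ^+ 2 + 2 * (g / 4 + T) * s ^+ 2) =
    2 * T * y ^+ 2 + 2 * b ^+ 2 / g * s ^+ 2 by field; rewrite gt_eqF.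
clearbody T; apply: addr_ge0; rewrite mulr_ge0 ?sqr_ge0 ?mulr_ge0//.
by rewrite invr_ge0 ltW.
Qed.

(** The spectral gap pays for test vectors that differ from [v]: on each test space the spike form
    lies on the favourable side of m_i |u|^2 by at least g (|u|^2 - y^2), which cancels the first
    error term of [quad_decomposition]. *)
Lemma eigenvalue_perturbation k n (V : 'M[R]_(k, n)) (m : 'rV[R]_k)
    (W : 'M[R]_n) (i : 'I_k) g (v := row i V)
    (E := 2 * (v *m W *m (v *m W)^T) 0 0 / g
          + 2 * (4 ^+ 5 * cube_frobenius W / g ^+ 5)) :
  V *m V^T = 1%:M -> W^T = W -> 0 < g -> g <= m 0 i ->
  (forall j : 'I_k, (j < i)%N -> m 0 i + g <= m 0 j) ->
  (forall j : 'I_k, (i < j)%N -> m 0 j <= m 0 i - g) ->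
  `|nth_eigenvalue (V^T *m diag_mx m *m V + W) i
     - (m 0 i + (v *m W *m v^T) 0 0)| <= E.
Proof.
move=> VV symW g0 gm gt_m lt_m; set A := _ + W; set a := (v *m W *m v^T) 0 0.
have v1 : (v *m v^T) 0 0 = 1.
  transitivity ((V *m V^T) i i); last by rewrite VV mxE eqxx.
  by rewrite !mxE; apply: eq_bigr => j _; rewrite !mxE.
have symA : A^T = A.
  by rewrite /A linearD/= symW !trmx_mul trmxK tr_diag_mx mulmxA.
have kn : (k <= n)%N.
  by rewrite -(mxrank1 R k) -VV (leq_trans (mxrankM_maxl _ _))// rank_leq_col.
have lt_in : (i < n)%N := leq_trans (ltn_ord i) kn.
have uv (u : 'rV_n) : (u *m v^T) 0 0 = (u *m V^T) 0 i.
  by rewrite !mxE; apply: eq_bigr => j _; rewrite !mxE.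
have addE (B C : 'M[R]_1) : (B + C) 0 0 = B 0 0 + C 0 0 by rewrite !mxE.
have AE (u : 'rV_n) : (u *m A *m u^T) 0 0 =
    \sum_j m 0 j * (u *m V^T) 0 j ^+ 2 + (u *m W *m u^T) 0 0.
  by rewrite /A mulmxDr mulmxDl addE (orthonormal_quad u erefl).
rewrite ler_norml; apply/andP; split.
- rewrite lerBrDl.
  pose f : 'I_i.+1 -> 'I_k := widen_ord (ltn_ord i).
  have V1 : rowsub f V *m (rowsub f V)^T = 1%:M.
    apply/matrixP => p q; transitivity ((V *m V^T) (f p) (f q)).
      by rewrite !mxE; apply: eq_bigr => c _; rewrite !mxE.
    by rewrite VV !mxE.
  apply: (@nth_eigenvalue_ge _ _ _ _ (rowsub f V)) => // x.
  set u := x *m rowsub f V.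
  have yE : u *m V^T = x *m rowsub f 1%:M by rewrite -mulmxA mul_rowsub_mx VV.
  have ux : (u *m u^T) 0 0 = (x *m x^T) 0 0 by exact: orthonormal_dot.
  have uy : (u *m u^T) 0 0 = \sum_j (u *m V^T) 0 j ^+ 2.
    rewrite ux -(@orthonormal_dot _ _ _ (rowsub f 1%:M)).
      by rewrite -yE dot_rvE; apply: eq_bigr => j _; rewrite expr2.
    apply/matrixP => p q; transitivity ((1%:M *m 1%:M^T : 'M[R]_k) (f p) (f q)).
      by rewrite !mxE; apply: eq_bigr => c _; rewrite !mxE.
    by rewrite trmx1 mulmx1 !mxE.
  have y0 (j : 'I_k) : (i < j)%N -> (u *m V^T) 0 j = 0.
    move=> ij; rewrite yE mxE big1// => p _; rewrite !mxE.
    have [/(congr1 val)/= pj|] := eqVneq (f p) j; last by rewrite mulr0.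
    by move: ij; rewrite -pj ltnNge -ltnS ltn_ord.
  have := quad_decomposition u symW g0 v1.
  rewrite -/a -/E uv -ux ler_norml => /andP[h _]; rewrite AE.
  have : (m 0 i + g) * (u *m u^T) 0 0 - g * (u *m V^T) 0 i ^+ 2 <=
      \sum_j m 0 j * (u *m V^T) 0 j ^+ 2.
    rewrite uy mulr_sumr (bigD1 i)//= [leRHS](bigD1 i)//=.
    rewrite mulrDl addrAC addrK lerD2l; apply: ler_sum => j ji.
    have [ij|ij|/val_inj ij] := ltngtP i j.
    + by rewrite y0// expr0n !mulr0.
    + by rewrite ler_wpM2r ?sqr_ge0// gt_m.
    + by rewrite ij eqxx in ji.
  move: h; move: (\sum_j _) ((u *m W *m u^T) 0 0) ((u *m u^T) 0 0) => p q r.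
  by move: ((u *m V^T) 0 i) => y; lra.
- rewrite lerBlDl.
  pose f : 'I_i -> 'I_k := widen_ord (ltnW (ltn_ord i)).
  apply: (@nth_eigenvalue_le _ _ _ _ (rowsub f V)) => // u uV.
  have y0 (j : 'I_k) : (j < i)%N -> (u *m V^T) 0 j = 0.
    move=> ji; have -> : j = f (Ordinal ji) by exact: val_inj.
    have := congr1 (fun X : 'rV[R]_i => X 0 (Ordinal ji)) uV; rewrite !mxE => {2}<-.
    by apply: eq_bigr => c _; rewrite !mxE.
  have := quad_decomposition u symW g0 v1.
  rewrite -/a -/E uv ler_norml => /andP[_ h]; rewrite AE.
  have : \sum_j m 0 j * (u *m V^T) 0 j ^+ 2 <=
      (m 0 i - g) * (u *m u^T) 0 0 + g * (u *m V^T) 0 i ^+ 2; last first.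
    move: h; move: (\sum_j _) ((u *m W *m u^T) 0 0) ((u *m u^T) 0 0) => p q r.
    by move: ((u *m V^T) 0 i) => y; lra.
  (* Off the span of [V] the spike form vanishes, so zero too must lie a gap below m_i: [g <= m 0 i]
     makes the coefficient nonnegative and lets Bessel's inequality apply. *)
  apply: (@le_trans _ _ ((m 0 i - g) * (\sum_j (u *m V^T) 0 j ^+ 2)
      + g * (u *m V^T) 0 i ^+ 2)); last first.
    by rewrite lerD2r ler_wpM2l ?subr_ge0// bessel.
  rewrite mulr_sumr (bigD1 i)//= [leRHS]addrC [X in _ <= _ + X](bigD1 i)//=.
  rewrite addrA -mulrDl [g + _]addrC subrK lerD2l; apply: ler_sum => j ji.
  have [ij|ij|/val_inj ij] := ltngtP i j.
  + by rewrite ler_wpM2r ?sqr_ge0// lt_m.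
  + by rewrite y0// expr0n !mulr0.
  + by rewrite ij eqxx in ji.
Qed.

End Perturbation.

(** * Random variables with moments of all orders *)

Section Moments.
Context d (T : measurableType d) (R : realType) (P : probability T R).
Implicit Types f g : T -> R.

(** Having all moments, unlike being integrable, is stable under products; every polynomial in the
    matrix entries then inherits it. *)
Definition has_moments f := measurable_fun setT f /\
  forall m, P.-integrable setT (EFin \o (fun x => `|f x| ^+ m)).

Lemma dominated_integrable f g : measurable_fun setT f ->
  P.-integrable setT (EFin \o g) -> (forall x, `|f x| <= g x) ->
  P.-integrable setT (EFin \o f).
Proof.
move=> mf ig fg; apply: le_integrable ig => //; first exact/measurable_EFinP.
by move=> x _ /=; rewrite lee_fin (le_trans (fg x))// ler_norm.
Qed.

Lemma has_moments_integrable f : has_moments f ->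
  P.-integrable setT (EFin \o f).
Proof.
move=> [mf /(_ 1%N) mf1]; apply: dominated_integrable mf mf1 _ => x.
by rewrite expr1.
Qed.

Lemma has_moments_le f g : measurable_fun setT f -> has_moments g ->
  (forall x, `|f x| <= `|g x|) -> has_moments f.
Proof.
move=> mf [mg ig] fg; split=> // m.
apply: dominated_integrable (ig m) _ => [|x].
  by apply: measurable_funX; exact: measurableT_comp.
by rewrite normrX normr_id lerXn2r// nnegrE.
Qed.

Lemma has_moments_cst c : has_moments (cst c).
Proof.
split=> // m; have -> : EFin \o (fun x : T => `|cst c x| ^+ m) = cst (`|c| ^+ m)%:E.
  by [].
exact: finite_measure_integrable_cst.
Qed.

Lemma has_momentsM f g : has_moments f -> has_moments g ->
  has_moments (fun x => f x * g x).
Proof.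
move=> [mf jf] [mg jg]; split=> [|m]; first exact: measurable_funM.
have ifg : P.-integrable setT
    (EFin \o (fun x => `|f x| ^+ (2 * m) + `|g x| ^+ (2 * m))).
  by have := integrableD measurableT (jf (2 * m)%N) (jg (2 * m)%N).
apply: dominated_integrable ifg _.
  by apply: measurable_funX; apply: measurableT_comp => //; exact: measurable_funM.
move=> x; rewrite normrX normr_id normrM exprMn (mulnC 2) !exprM.
have := exprn_ge0 m (normr_ge0 (f x)); have := exprn_ge0 m (normr_ge0 (g x)).
by move: (`|f x| ^+ m) (`|g x| ^+ m) => a b; nra.
Qed.

Lemma has_momentsD f g : has_moments f -> has_moments g ->
  has_moments (fun x => f x + g x).
Proof.
move=> [mf jf] [mg jg]; split=> [|m]; first exact: measurable_funD.
have ifg : P.-integrable setT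
    (EFin \o (fun x => 2 ^+ m * (`|f x| ^+ m + `|g x| ^+ m))).
  have := integrableZl measurableT (2 ^+ m) (integrableD measurableT (jf m) (jg m)).
  by [].
apply: dominated_integrable ifg _.
  by apply: measurable_funX; apply: measurableT_comp => //; exact: measurable_funD.
move=> x; rewrite normrX normr_id.
have [fg|/ltW gf] := leP `|f x| `|g x|.
  apply: (@le_trans _ _ ((2 * `|g x|) ^+ m)).
    rewrite lerXn2r ?nnegrE ?mulr_ge0//.
    by rewrite (le_trans (ler_normD _ _))// mulr_natl mulr2n lerD2r.
  by rewrite exprMn ler_wpM2l ?exprn_ge0// lerDr exprn_ge0.
apply: (@le_trans _ _ ((2 * `|f x|) ^+ m)).
  rewrite lerXn2r ?nnegrE ?mulr_ge0//.
  by rewrite (le_trans (ler_normD _ _))// mulr_natl mulr2n lerD2l.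
by rewrite exprMn ler_wpM2l ?exprn_ge0// lerDl exprn_ge0.
Qed.

Lemma has_momentsZ c f : has_moments f -> has_moments (fun x => c * f x).
Proof. by move=> mf; apply: has_momentsM => //; exact: has_moments_cst. Qed.

Lemma has_moments_sum I (s : seq I) (p : pred I) (F : I -> T -> R) :
  (forall i, p i -> has_moments (F i)) ->
  has_moments (fun x => \sum_(i <- s | p i) F i x).
Proof.
move=> mF; elim: s => [|i s IH].
  by under eq_fun do rewrite big_nil; exact: has_moments_cst.
under eq_fun do rewrite big_cons; case: (boolP (p i)) => // pi.
by apply: has_momentsD => //; exact: mF.
Qed.

Lemma has_moments_prod I (s : seq I) (p : pred I) (F : I -> T -> R) :
  (forall i, p i -> has_moments (F i)) ->
  has_moments (fun x => \prod_(i <- s | p i) F i x).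
Proof.
move=> mF; elim: s => [|i s IH].
  by under eq_fun do rewrite big_nil; exact: has_moments_cst.
under eq_fun do rewrite big_cons; case: (boolP (p i)) => // pi.
by apply: has_momentsM => //; exact: mF.
Qed.

Lemma has_momentsX f n : has_moments f -> has_moments (fun x => f x ^+ n).
Proof.
move=> mf; elim: n => [|n IH].
  by under eq_fun do rewrite expr0; exact: has_moments_cst.
by under eq_fun do rewrite exprS; exact: has_momentsM.
Qed.

Lemma has_moments_indic (X : T -> R) (A : set R) : measurable_fun setT X ->
  measurable A -> has_moments (fun x => \1_A (X x)).
Proof.
move=> mX mA; apply: has_moments_le (has_moments_cst 1) _.
  by apply: measurableT_comp => //.
by move=> x; rewrite indicE normr1 ger0_norm// lern1 leq_b1.
Qed.

Lemma meanD f g : has_moments f -> has_moments g ->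
  \int[P]_x (f x + g x) = \int[P]_x f x + \int[P]_x g x.
Proof. by move=> mf mg; rewrite RintegralD//; exact: has_moments_integrable. Qed.

Lemma meanZ c f : has_moments f -> \int[P]_x (c * f x) = c * \int[P]_x f x.
Proof. by move=> mf; rewrite RintegralZl//; exact: has_moments_integrable. Qed.

Lemma mean_cst c : \int[P]_x c = c.
Proof. by have := expectation_cst P c; rewrite unlock /Rintegral => ->. Qed.

Lemma mean_sum I (s : seq I) (p : pred I) (F : I -> T -> R) :
  (forall i, p i -> has_moments (F i)) ->
  \int[P]_x (\sum_(i <- s | p i) F i x) = \sum_(i <- s | p i) \int[P]_x F i x.
Proof.
move=> mF; elim: s => [|i s IH].
  by under eq_Rintegral do rewrite big_nil; rewrite mean_cst big_nil.
under eq_Rintegral do rewrite big_cons; rewrite big_cons; case: ifP => // pi.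
by rewrite meanD ?IH//; [exact: mF|exact: has_moments_sum].
Qed.

Lemma mean_le f g : has_moments f -> has_moments g ->
  (forall x, f x <= g x) -> \int[P]_x f x <= \int[P]_x g x.
Proof.
by move=> mf mg fg; apply: le_Rintegral => //; exact: has_moments_integrable.
Qed.

Lemma expectationE f : has_moments f -> 'E_P[f]%E = (\int[P]_x f x)%:E.
Proof.
move=> mf; rewrite unlock fineK//.
exact: integrable_fin_num (has_moments_integrable mf).
Qed.

(* The integral of a function that is not measurable is the difference of the
   lower integrals of its positive and negative parts, so it is monotone. *)
Lemma le_integral_lower (f g : T -> \bar R) : (forall x, f x <= g x)%E ->
  (\int[P]_x f x <= \int[P]_x g x)%E.
Proof.
move=> fg; rewrite /integral /= !patch_setT; apply: leeB.
- apply: le_ereal_sup => _ [h hf <-]; exists h => // x.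
  apply: (le_trans (hf x)); apply: (@funepos_le _ _ setT) => [y _|]; last first.
    by rewrite inE.
  exact: fg.
- apply: le_ereal_sup => _ [h hf <-]; exists h => // x.
  apply: (le_trans (hf x)); apply: (@funeneg_le _ _ setT) => [y _|]; last first.
    by rewrite inE.
  exact: fg.
Qed.

(** Meant for [f] an eigenvalue of a random matrix, about whose measurability nothing is assumed:
    the integral is monotone on arbitrary functions, and the two bounds force it to be finite. *)
Lemma expectation_between f g1 g2 : has_moments g1 -> has_moments g2 ->
  (forall x, g1 x <= f x <= g2 x) ->
  exists2 e, 'E_P[f]%E = e%:E & \int[P]_x g1 x <= e <= \int[P]_x g2 x.
Proof.
move=> m1 m2 fg.
have le1 : ((\int[P]_x g1 x)%:E <= 'E_P[f])%E.
  rewrite -expectationE// unlock; apply: le_integral_lower => x.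
  by rewrite lee_fin; case/andP: (fg x).
have le2 : ('E_P[f] <= (\int[P]_x g2 x)%:E)%E.
  rewrite -expectationE// unlock; apply: le_integral_lower => x.
  by rewrite lee_fin; case/andP: (fg x).
have fE : 'E_P[f]%E \is a fin_num.
  rewrite fin_numE; apply/andP; split; apply/eqP => E.
    by move: le1; rewrite E.
  by move: le2; rewrite E.
exists (fine 'E_P[f]%E); first by rewrite fineK.
by move: le1 le2; rewrite -(fineK fE) !lee_fin => -> ->.
Qed.

Import HBNNSimple.

(** The last hypothesis is the only trace of independence between [X] and [Z]. It extends from
    indicators to simple functions by linearity, to nonnegative [g] by dominated convergence, and to
    signed [g] by splitting it into positive and negative parts. *)
Lemma mean_mul_simple (X : {RV P >-> R}) (Z : T -> R) (s : {nnsfun R >-> R}) :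
  has_moments Z ->
  (forall A, measurable A ->
     \int[P]_x (\1_A (X x) * Z x) = fine (P (X @^-1` A)) * \int[P]_x Z x) ->
  \int[P]_x (s (X x) * Z x) = \int[P]_x s (X x) * \int[P]_x Z x.
Proof.
move=> mZ XZ.
have mX : measurable_fun setT X by [].
have mA y : measurable (s @^-1` [set y]) by exact: measurable_sfunP.
have mI y : has_moments (fun x => \1_(s @^-1` [set y]) (X x)).
  exact: has_moments_indic.
have sE x : s (X x) = \sum_(y <- finmap.enum_fset (fset_set (range s)))
    y * \1_(s @^-1` [set y]) (X x).
  by rewrite fimfunE fsbig_finite.
under eq_Rintegral do rewrite sE mulr_suml.
rewrite mean_sum => [|y _]; last by apply: has_momentsM => //; exact: has_momentsZ.
under [in RHS]eq_Rintegral do rewrite sE.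
rewrite mean_sum => [|y _]; last exact: has_momentsZ.
rewrite mulr_suml; apply: eq_bigr => y _.
rewrite meanZ// -mulrA; under eq_Rintegral do rewrite -mulrA.
rewrite meanZ ?XZ//; last exact: has_momentsM.
congr (_ * (_ * _)).
have mXA : measurable (X @^-1` (s @^-1` [set y])).
  by rewrite -[X in measurable X]setTI; exact: mX.
by have := expectation_indic P mXA; rewrite unlock /Rintegral => ->.
Qed.

Lemma mean_mul_nonneg (X : {RV P >-> R}) (Z : T -> R) (g : R -> R) :
  has_moments Z -> measurable_fun setT g -> (forall y, 0 <= g y) ->
  has_moments (fun x => g (X x)) ->
  (forall A, measurable A ->
     \int[P]_x (\1_A (X x) * Z x) = fine (P (X @^-1` A)) * \int[P]_x Z x) ->
  \int[P]_x (g (X x) * Z x) = \int[P]_x g (X x) * \int[P]_x Z x.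
Proof.
move=> mZ mg g0 mgX XZ.
have mg' : measurable_fun setT (EFin \o g) by exact/measurable_EFinP.
pose s := nnsfun_approx measurableT mg'.
have s_le n y : `|s n y| <= `|g y|.
  rewrite !ger0_norm// -lee_fin nnsfun_approxE; apply: le_approx => // z _.
  by rewrite lee_fin.
have s_cvg y : (fun n => (s n y)%:E) @ \oo --> (g y)%:E.
  by apply: (cvg_nnsfun_approx measurableT mg') => // z _; rewrite lee_fin.
have msX n : has_moments (fun x => s n (X x)).
  apply: has_moments_le mgX _ => //; exact: measurableT_comp.
have lim (Y : T -> R) : has_moments Y ->
    (fun n => \int[P]_x (s n (X x) * Y x)) @ \oo --> \int[P]_x (g (X x) * Y x).
  move=> mY; have mgY := has_momentsM mgX mY.
  have := @dominated_convergence _ _ _ P setT measurableT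
    (fun n x => (s n (X x) * Y x)%:E) (fun x => (g (X x) * Y x)%:E)
    (fun x => `|g (X x) * Y x|%:E).
  move=> [].
  - by move=> n; apply/measurable_EFinP; case: (has_momentsM (msX n) mY).
  - by apply/measurable_EFinP; case: mgY.
  - apply: aeW => x _; rewrite EFinM; under eq_fun do rewrite EFinM.
    by apply: cvgeZr => //; exact: s_cvg.
  - exact/integrable_norm/has_moments_integrable.
  - by apply: aeW => x n _; rewrite lee_fin !normrM ler_wpM2r.
  move=> _ _ h; apply: fine_cvg; rewrite fineK//.
  by apply: integrable_fin_num => //; exact: has_moments_integrable.
have h1 := lim _ mZ.
have h2 := lim _ (has_moments_cst 1).
have {}h2 : (fun n => \int[P]_x (s n (X x) * Z x)) @ \oo -->
    \int[P]_x g (X x) * \int[P]_x Z x.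
  have E f : \int[P]_x (f x * cst 1 x) = \int[P]_x f x.
    by apply: eq_Rintegral => x _; rewrite mulr1.
  have : (fun n => \int[P]_x (s n (X x) * cst 1 x) * \int[P]_x Z x) @ \oo -->
      \int[P]_x (g (X x) * cst 1 x) * \int[P]_x Z x.
    exact: cvgM h2 (cvg_cst _).
  by rewrite E; under eq_fun do rewrite E -mean_mul_simple//.
exact: cvg_unique h1 h2.
Qed.

Lemma mean_mul (X : {RV P >-> R}) (Z : T -> R) (g : R -> R) :
  has_moments Z -> measurable_fun setT g ->
  has_moments (fun x => g (X x)) ->
  (forall A, measurable A ->
     \int[P]_x (\1_A (X x) * Z x) = fine (P (X @^-1` A)) * \int[P]_x Z x) ->
  \int[P]_x (g (X x) * Z x) = \int[P]_x g (X x) * \int[P]_x Z x.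
Proof.
move=> mZ mg mgX XZ.
have mX : measurable_fun setT X by [].
pose gp y := Num.max (g y) 0; pose gn y := Num.max (- g y) 0.
have gE y : g y = gp y + -1 * gn y.
  rewrite /gp /gn; have [h|/ltW h] := leP 0 (g y).
    by rewrite max_r ?oppr_le0// mulr0 addr0.
  by rewrite max_l ?oppr_ge0// mulN1r opprK add0r.
have gp0 y : 0 <= gp y by rewrite le_max lexx orbT.
have gn0 y : 0 <= gn y by rewrite le_max lexx orbT.
have mgp : measurable_fun setT gp by apply: measurable_maxr.
have mgn : measurable_fun setT gn.
  by apply: measurable_maxr => //; exact: measurableT_comp.
have mgpX : has_moments (fun x => gp (X x)).
  apply: has_moments_le mgX _ => [|x]; first exact: measurableT_comp.
  by rewrite ger0_norm// ge_max ler_norm normr_ge0.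
have mgnX : has_moments (fun x => gn (X x)).
  apply: has_moments_le mgX _ => [|x]; first exact: measurableT_comp.
  by rewrite ger0_norm// ge_max -normrN ler_norm normr_ge0.
under eq_Rintegral do rewrite gE mulrDl -mulrA.
under [in RHS]eq_Rintegral do rewrite gE.
rewrite !meanD ?meanZ//; try by do ?apply: has_momentsZ; do ?apply: has_momentsM.
- by rewrite !mean_mul_nonneg// mulrDl mulrA.
Qed.

End Moments.

(** * Moments of products of independent variables *)

Section Independence.
Context d (T : measurableType d) (R : realType) (P : probability T R).
Variables (I : finType) (D : {set I}) (X : I -> {RV P >-> R}).
Hypothesis indepX : mutually_independent D X.
Hypothesis momX : forall p, p \in D -> has_moments P (X p).

(** Interpolates between the definition of independence ([J] empty, only events) and the product
    formula for powers ([J] equal to [D]). Each step turns the event of one variable [q] into a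
    power: since that event is arbitrary in the induction hypothesis, [mean_mul] applies to
    [X q]. *)
Lemma mean_prod_mixed (J : {set I}) (m : I -> nat) (A : I -> set R) :
  (J \subset D)%SET -> (forall p, measurable (A p)) ->
  \int[P]_x ((\prod_(p in J) X p x ^+ m p) *
             \prod_(p in (D :\: J)%SET) \1_(A p) (X p x)) =
  (\prod_(p in J) \int[P]_x (X p x ^+ m p)) *
  \prod_(p in (D :\: J)%SET) fine (P (X p @^-1` A p)).
Proof.
have [n] := ubnP #|J|; elim: n J A => // n IH J A Jn JD mA.
have mX p : measurable_fun setT (X p) by [].
have mXA p B : measurable B -> measurable (X p @^-1` B).
  by move=> mB; rewrite -[X in measurable X]setTI; exact: mX.
have [->|[q qJ]] := set_0Vmem J.
  rewrite finset.setD0 !big_set0 mul1r.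
  pose S := \bigcap_(p in [set` D]) (X p @^-1` A p).
  have mS : measurable S.
    by apply: fin_bigcap_measurable => // p _; exact: mXA.
  transitivity (\int[P]_x \1_S x).
    apply: eq_Rintegral => x _; rewrite big_set0 mul1r indicE.
    have [xS|xS] := boolP (x \in S).
      apply: big1 => p pD; rewrite indicE mem_set//.
      by move: xS; rewrite inE => /(_ p pD).
    have [p pD xp] : exists2 p, p \in D & ~ A p (X p x).
      apply: contrapT => h; move/negP: xS; apply; rewrite inE => p pD.
      by apply: contrapT => h'; apply: h; exists p.
    by rewrite (bigD1 p)//= indicE memNset// mul0r.
  have := expectation_indic P mS; rewrite unlock /Rintegral => ->.
  rewrite /S indepX//.
  rewrite (eq_bigr (fun p => (fine (P (X p @^-1` A p)))%:E)); last first.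
    by move=> p _; rewrite fineK// fin_num_measure//; exact: mXA.
  by rewrite prodEFin.
pose J' := (J :\ q)%SET.
have qD : q \in D by exact: (fintype.subsetP JD).
have J'D : (J' \subset D)%SET.
  by apply/fintype.subsetP => p; rewrite !inE => /andP[_ /(fintype.subsetP JD)].
have DJ : (D :\: J' = q |: (D :\: J))%SET.
  apply/setP => p; rewrite !inE negb_and negbK.
  by have [->|] := eqVneq p q; rewrite ?qD ?orbT.
have qDJ : q \notin (D :\: J)%SET by rewrite !inE qJ.
pose Z x := (\prod_(p in J') X p x ^+ m p) *
  \prod_(p in (D :\: J)%SET) \1_(A p) (X p x).
pose c := (\prod_(p in J') \int[P]_x (X p x ^+ m p)) *
  \prod_(p in (D :\: J)%SET) fine (P (X p @^-1` A p)).
have ZE B : measurable B ->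
    \int[P]_x (\1_B (X q x) * Z x) = fine (P (X q @^-1` B)) * c.
  (* The induction hypothesis for [J'] is used with the event [B] at [q] and the given events
     elsewhere. *)
  move=> mB; pose A' p := if p == q then B else A p.
  have A'E p : p \in (D :\: J)%SET -> A' p = A p.
    by rewrite /A'; case: eqP => // ->; rewrite (negbTE qDJ).
  have := IH J' A' _ J'D _; rewrite DJ !big_setU1//= /A' eqxx.
  under eq_Rintegral => x _ do rewrite big_setU1//= eqxx mulrCA.
  rewrite mulrCA => h; rewrite /Z /c.
  have -> : \prod_(p in (D :\: J)%SET) fine (P (X p @^-1` A p)) =
      \prod_(p in (D :\: J)%SET) fine (P (X p @^-1` A' p)).
    by apply: eq_bigr => p pDJ; rewrite A'E.
  rewrite -h.
  - apply: eq_Rintegral => x _; congr (_ * (_ * _)).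
    by apply: eq_bigr => p pDJ; have := A'E p pDJ; rewrite /A' => ->.
  - by rewrite -ltnS (leq_trans _ Jn)// ltnS [in leqRHS](cardsD1 q) qJ.
  - by move=> p; case: ifP.
have mZ : has_moments P Z.
  apply: has_momentsM; apply: has_moments_prod => p pJ.
    by apply: has_momentsX; apply: momX; exact: (fintype.subsetP J'D).
  exact: has_moments_indic.
(* The event of full measure identifies the constant [c] as the mean of [Z]. *)
have intZ : \int[P]_x Z x = c.
  have := ZE setT measurableT; rewrite preimage_setT probability_setT mul1r => <-.
  by apply: eq_Rintegral => x _; rewrite indicE in_setT mul1r.
rewrite (big_setD1 q)//= -mulrA -/J' -/c.
under eq_Rintegral => x _ do rewrite (big_setD1 q)//= -mulrA -/J' -/(Z x).
rewrite (@mean_mul _ _ _ _ (X q) Z (fun y => y ^+ m q))// ?intZ//.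
by apply: has_momentsX; exact: momX.
Qed.

Lemma mean_prod (m : I -> nat) :
  \int[P]_x (\prod_(p in D) X p x ^+ m p) =
  \prod_(p in D) \int[P]_x (X p x ^+ m p).
Proof.
have := @mean_prod_mixed D m (fun=> setT) (subxx _) (fun=> measurableT).
rewrite finset.setDv big_set0 mulr1 => <-.
by apply: eq_Rintegral => x _; rewrite big_set0 mulr1.
Qed.

Lemma prod_count (x : T) (s : seq I) : {subset s <= D} ->
  \prod_(p <- s) X p x = \prod_(p in D) X p x ^+ count_mem p s.
Proof.
elim: s => [|q s IH] sD; first by rewrite big_nil big1.
have qD : q \in D by rewrite sD// mem_head.
rewrite big_cons IH => [|p ps]; last by rewrite sD// inE ps orbT.
rewrite [RHS](bigD1 q)//= eqxx exprD expr1 -mulrA; congr (_ * _).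
rewrite (bigD1 q)//=; congr (_ * _); apply: eq_bigr => p /andP[_ pq].
by rewrite eq_sym (negbTE pq).
Qed.

Lemma mean_prod_eq0 (s : seq I) (q : I) : {subset s <= D} ->
  \int[P]_x X q x = 0 -> count_mem q s = 1%N ->
  \int[P]_x (\prod_(p <- s) X p x) = 0.
Proof.
move=> sD q0 qs; have qD : q \in D by apply: sD; rewrite -has_pred1 has_count qs.
under eq_Rintegral => x _ do rewrite (prod_count x sD).
rewrite mean_prod (bigD1 q)//= qs.
by under eq_Rintegral => x _ do rewrite expr1; rewrite q0 mul0r.
Qed.

(** The product is at most the [size s]-th power of its largest factor, which is one of the
    summands. In expectation this replaces Hölder's inequality at the price of a factor [size s]. *)
Lemma prod_norm_le (x : I -> R) (s : seq I) : (0 < size s)%N ->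
  `|\prod_(p <- s) x p| <= \sum_(p <- s) `|x p| ^+ size s.
Proof.
case: s => // a s _; set t := a :: s.
have [q qt qmax] : exists2 q, q \in t & forall p, p \in t -> `|x p| <= `|x q|.
  case: (@arg_maxP _ _ _ a (fun p => p \in t) (fun p => `|x p|)).
    exact: mem_head.
  by move=> q qt h; exists q.
apply: (@le_trans _ _ (`|x q| ^+ size t)).
  elim: (t) qmax => [|p u IH] qmax; first by rewrite big_nil normr1 expr0.
  rewrite big_cons normrM exprS ler_pM//; first by rewrite qmax ?mem_head.
  by rewrite IH// => r ru; rewrite qmax// inE ru orbT.
rewrite (big_rem q)//= lerDl sumr_ge0// => p _; exact: exprn_ge0.
Qed.

Lemma mean_prod_le (s : seq I) (K : R) : (0 < size s)%N -> {subset s <= D} ->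
  (forall p, p \in D -> \int[P]_x (`|X p x| ^+ size s) <= K) ->
  \int[P]_x (\prod_(p <- s) X p x) <= (size s)%:R * K.
Proof.
move=> s0 sD XK.
have mN p : p \in s -> has_moments P (fun x => `|X p x| ^+ size s).
  move=> ps; apply: has_momentsX; apply: has_moments_le (momX (sD _ ps)) _.
    by apply: measurableT_comp => //.
  by move=> x; rewrite normr_id.
have mS : has_moments P (fun x => \sum_(p <- s) `|X p x| ^+ size s).
  under eq_fun do rewrite big_seq; exact: has_moments_sum.
apply: (@le_trans _ _ (\int[P]_x (\sum_(p <- s) `|X p x| ^+ size s))).
  apply: mean_le => // [|x]; last first.
    by apply: le_trans (prod_norm_le (fun p => X p x) s0); exact: ler_norm.
  under eq_fun do rewrite big_seq; apply: has_moments_prod => p ps.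
  by apply: momX; exact: sD.
under eq_Rintegral => x _ do rewrite big_seq.
rewrite mean_sum//.
have -> : (size s)%:R * K = \sum_(p <- s) K.
  by rewrite big_const_seq count_predT iter_addr_0 mulr_natl.
by rewrite [leRHS]big_seq; apply: ler_sum => p ps; rewrite XK// sD.
Qed.

End Independence.

(** * Moments of Wigner matrices *)

Section Walks.

(* The entries of W in W_ac W_cd W_db W_ae W_eg W_gb, a term of (W^3)_ab^2. *)
Definition walk_edges (A : Type) (a b c d e g : A) : seq (A * A) :=
  [:: (a, c); (c, d); (d, b); (a, e); (e, g); (g, b)].

Definition same_edge (A : eqType) (p q : A * A) :=
  (p.1 == q.1) && (p.2 == q.2) || (p.1 == q.2) && (p.2 == q.1).

Definition no_single_edge (A : eqType) (a b c d e g : A) :=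
  let s := walk_edges a b c d e g in
  all (fun p => count (same_edge p) s != 1%N) s.

(** The six edges form the closed walk a c d b g e a. If each occurs at least twice, at most three
    are distinct, and a connected graph with three edges has at most four vertices. The check is an
    exhaustive run over 6^6 labellings. *)
Lemma no_single_edge_labels :
  let labels := iota 0 6 in
  all (fun a => all (fun b => all (fun c =>
  all (fun d => all (fun e => all (fun g =>
    no_single_edge a b c d e g ==> (size (undup [:: a; b; c; d; e; g]) <= 4)%N)
  labels) labels) labels) labels) labels) labels.
Proof. by vm_compute. Qed.

(* Only the pattern of coincidences among the six vertices matters, so it is
   enough to check labels below 6. *)
Lemma no_single_edge_size (A : eqType) (a b c d e g : A) :
  no_single_edge a b c d e g -> (size (undup [:: a; b; c; d; e; g]) <= 4)%N.
Proof.
set s := [:: a; b; c; d; e; g]; pose f x := index x s.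
have fE x y : x \in s -> y \in s -> (f x == f y) = (x == y).
  move=> xs ys; apply/eqP/eqP => [|->//] fxy.
  by rewrite -(nth_index a xs) -(nth_index a ys) -/(f x) fxy.
have f6 x : x \in s -> f x \in iota 0 6.
  by move=> xs; rewrite mem_iota -[X in (_ < X)%N]/(size s) index_mem.
have [sa sb sc sd [se sg]] :
    [/\ a \in s, b \in s, c \in s, d \in s & e \in s /\ g \in s].
  by split; [..|split]; rewrite !inE eqxx ?orbT.
have sf : (size (undup s) <= size (undup [seq f x | x <- s]))%N.
  rewrite -(size_map (nth a s) (undup (map f s))).
  apply: uniq_leq_size (undup_uniq _) _ => x; rewrite mem_undup => xs.
  apply/mapP; exists (f x); last by rewrite nth_index.
  by rewrite mem_undup map_f.
move=> H; apply: (leq_trans sf); move: H; have := no_single_edge_labels.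
move=> /allP/(_ _ (f6 _ sa))/allP/(_ _ (f6 _ sb))/allP/(_ _ (f6 _ sc)).
move=> /allP/(_ _ (f6 _ sd))/allP/(_ _ (f6 _ se))/allP/(_ _ (f6 _ sg)).
move=> /implyP h H; apply: h; move: H.
by rewrite /no_single_edge /same_edge /= !fE.
Qed.

(* The index order (a, b, c, e, d, g) is the one produced by expanding the
   square of (W^3)_ab. *)
Definition six_no_single_edge (A : eqType) (t : A * A * A * A * A * A) :=
  let: (a, b, c, e, d, g) := t in no_single_edge a b c d e g.

(** A tuple with at most four distinct entries factors through four slots: [L] records the slot of
    each position, and the function fills the slots. *)
Lemma card_no_single_edge n :
  (#|[pred t : 'I_n * 'I_n * 'I_n * 'I_n * 'I_n * 'I_n | six_no_single_edge t]|
   <= 4 ^ 6 * n ^ 4)%N.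
Proof.
pose L : finType := ('I_4 * 'I_4 * 'I_4 * 'I_4 * 'I_4 * 'I_4)%type.
pose F (z : L * {ffun 'I_4 -> 'I_n}) :=
  let: (a, b, c, d, e, g) := z.1 in
  let h := z.2 in (h a, h b, h c, h d, h e, h g).
apply: (@leq_trans #|(F @: [set: L * {ffun 'I_4 -> 'I_n}])%SET|).
  apply: subset_leq_card; apply/fintype.subsetP => -[[[[[a b] c] e] d] g].
  rewrite inE /= => /no_single_edge_size.
  set s := [:: a; b; c; d; e; g]; set u := undup s => u4.
  pose h := [ffun i : 'I_4 => nth a u i].
  pose l x : 'I_4 := inord (index x u).
  have hl x : x \in s -> h (l x) = x.
    move=> xs; rewrite ffunE inordK ?nth_index ?mem_undup//.
    by rewrite (leq_trans _ u4)// index_mem mem_undup.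
  apply/imsetP; exists ((l a, l b, l c, l e, l d, l g), h); first by rewrite inE.
  by rewrite /F /= !hl// !inE eqxx ?orbT.
apply: (leq_trans (leq_imset_card _ _)); rewrite cardsT.
by rewrite !card_prod card_ffun !card_ord !expnS expn0 !mulnA !muln1.
Qed.

End Walks.

Section Edges.
Variable N : nat.

Definition sort_edge (p : 'I_N * 'I_N) := if (p.1 <= p.2)%N then p else (p.2, p.1).

Lemma sort_edge_upper p :
  sort_edge p \in [set p : 'I_N * 'I_N | (p.1 <= p.2)%N]%SET.
Proof.
rewrite inE /sort_edge; case: ifP => //= /negbT; rewrite -ltnNge; exact: ltnW.
Qed.

Lemma sort_edge_eq p q : (sort_edge q == sort_edge p) = same_edge p q.
Proof.
case: p q => [a b] [c e]; rewrite /sort_edge /same_edge /=.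
case: leqP => ce; case: leqP => ab; rewrite xpair_eqE.
all: by rewrite -!val_eqE /=; lia.
Qed.

Lemma tr_Wigner (R : realType) (X : 'I_N -> 'I_N -> R) : (Wigner X)^T = Wigner X.
Proof.
apply/matrixP => a b; rewrite !mxE; case: ltngtP => // ab.
by have -> : a = b by exact: val_inj.
Qed.

End Edges.

Section WignerMoments.
Context d (T : measurableType d) (R : realType) (P : probability T R).
Variables (N : nat) (X : 'I_N -> 'I_N -> {RV P >-> R}).
Notation upper := [set p : 'I_N * 'I_N | (p.1 <= p.2)%N]%SET.
Hypothesis indepX : mutually_independent upper (fun p => X p.1 p.2).
Hypothesis momX : forall j l : 'I_N, (j <= l)%N -> has_moments P (X j l).
Hypothesis meanX : forall j l : 'I_N, (j <= l)%N -> \int[P]_x X j l x = 0.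

Notation W := (fun w => Wigner (fun j l => X j l w)).

Lemma WignerE w a b :
  W w a b = X (sort_edge (a, b)).1 (sort_edge (a, b)).2 w.
Proof. by rewrite mxE /sort_edge /=; case: ifP. Qed.

Lemma has_moments_Wigner a b : has_moments P (fun w => W w a b).
Proof.
under eq_fun do rewrite WignerE; apply: momX.
by have := sort_edge_upper (a, b); rewrite inE.
Qed.

Lemma has_moments_edges (s : seq ('I_N * 'I_N)) :
  has_moments P (fun w => \prod_(p <- s) W w p.1 p.2).
Proof. by apply: has_moments_prod => p _; exact: has_moments_Wigner. Qed.

Lemma prod_edgesE w (s : seq ('I_N * 'I_N)) :
  \prod_(p <- s) W w p.1 p.2 = \prod_(p <- map (@sort_edge N) s) X p.1 p.2 w.
Proof. by rewrite big_map; apply: eq_bigr => -[a b] _; rewrite WignerE. Qed.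

Lemma map_sort_edge_upper (s : seq ('I_N * 'I_N)) :
  {subset map (@sort_edge N) s <= upper}.
Proof. by move=> _ /mapP[p _ ->]; exact: sort_edge_upper. Qed.

Let momU p : p \in upper -> has_moments P (X p.1 p.2).
Proof. by rewrite inE => /momX. Qed.

Lemma mean_edges_eq0 (s : seq ('I_N * 'I_N)) p :
  count (same_edge p) s = 1%N -> \int[P]_x (\prod_(q <- s) W x q.1 q.2) = 0.
Proof.
move=> ps; under eq_Rintegral => x _ do rewrite prod_edgesE.
apply: (mean_prod_eq0 (q := sort_edge p) indepX momU).
- exact: map_sort_edge_upper.
- by apply: meanX; have := sort_edge_upper p; rewrite inE.
- by rewrite count_map -ps; apply: eq_count => q /=; exact: sort_edge_eq.
Qed.

Lemma mean_edges_le (s : seq ('I_N * 'I_N)) K : (0 < size s)%N ->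
  (forall j l : 'I_N, (j <= l)%N -> \int[P]_x (`|X j l x| ^+ size s) <= K) ->
  \int[P]_x (\prod_(q <- s) W x q.1 q.2) <= (size s)%:R * K.
Proof.
move=> s0 XK; under eq_Rintegral => x _ do rewrite prod_edgesE.
rewrite -(size_map (@sort_edge N)); apply: (mean_prod_le momU).
- by rewrite size_map.
- exact: map_sort_edge_upper.
- by move=> p; rewrite inE size_map => /XK.
Qed.

Lemma mean_Wigner a b : \int[P]_x W x a b = 0.
Proof.
rewrite -(@mean_edges_eq0 [:: (a, b)] (a, b)).
  by apply: eq_Rintegral => x _; rewrite big_seq1.
by rewrite /= /same_edge /= !eqxx.
Qed.

Lemma quad_WignerE (v : 'rV[R]_N) w :
  (v *m W w *m v^T) 0 0 = \sum_b \sum_a (v 0 a * v 0 b) * W w a b.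
Proof.
rewrite dot_rvE; apply: eq_bigr => b _; rewrite mxE mulr_suml.
by apply: eq_bigr => a _; rewrite mulrAC.
Qed.

Lemma has_moments_quad (v : 'rV[R]_N) :
  has_moments P (fun w => (v *m W w *m v^T) 0 0).
Proof.
under eq_fun do rewrite quad_WignerE.
do 2 (apply: has_moments_sum => ? _).
by apply: has_momentsZ; exact: has_moments_Wigner.
Qed.

Lemma mean_quad (v : 'rV[R]_N) : \int[P]_x ((v *m W x *m v^T) 0 0) = 0.
Proof.
under eq_Rintegral => x _ do rewrite quad_WignerE.
rewrite mean_sum => [|b _]; last first.
  by apply: has_moments_sum => a _; apply: has_momentsZ; exact: has_moments_Wigner.
apply: big1 => b _; rewrite mean_sum => [|a _]; last first.
  by apply: has_momentsZ; exact: has_moments_Wigner.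
apply: big1 => a _; rewrite meanZ ?mean_Wigner ?mulr0//.
exact: has_moments_Wigner.
Qed.

Lemma sq_WignerE (v : 'rV[R]_N) w :
  (v *m W w *m (v *m W w)^T) 0 0 =
  \sum_b \sum_a \sum_c (v 0 a * v 0 c) *
    \prod_(q <- [:: (a, b); (c, b)]) W w q.1 q.2.
Proof.
rewrite dot_rvE; apply: eq_bigr => b _; rewrite !mxE big_distrlr /=.
apply: eq_bigr => a _; apply: eq_bigr => c _.
by rewrite !big_cons big_nil /=; ring.
Qed.

Lemma has_moments_sq (v : 'rV[R]_N) :
  has_moments P (fun w => (v *m W w *m (v *m W w)^T) 0 0).
Proof.
under eq_fun do rewrite sq_WignerE.
do 3 (apply: has_moments_sum => ? _).
by apply: has_momentsZ; exact: has_moments_edges.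
Qed.

Lemma mean_sq_le (K2 : R) (v : 'rV[R]_N) :
  (forall j l : 'I_N, (j <= l)%N -> \int[P]_x (`|X j l x| ^+ 2) <= K2) ->
  \int[P]_x ((v *m W x *m (v *m W x)^T) 0 0) <=
  N%:R * (2 * K2) * (v *m v^T) 0 0.
Proof.
move=> X2.
under eq_Rintegral => x _ do rewrite sq_WignerE.
rewrite mean_sum => [|b _]; last first.
  do 2 (apply: has_moments_sum => ? _).
  by apply: has_momentsZ; exact: has_moments_edges.
have -> : N%:R * (2 * K2) * (v *m v^T) 0 0 =
    \sum_(b < N) \sum_a v 0 a * v 0 a * (2 * K2).
  by rewrite sumr_const card_ord -mulr_suml -dot_rvE -mulr_natl; ring.
apply: ler_sum => b _; rewrite mean_sum => [|a _]; last first.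
  by apply: has_moments_sum => ? _; apply: has_momentsZ; exact: has_moments_edges.
apply: ler_sum => a _; rewrite mean_sum => [|c _]; last first.
  by apply: has_momentsZ; exact: has_moments_edges.
(* For [c] different from [a] the edges (a, b) and (c, b) are distinct even up to orientation, since
   a = b and b = c would give a = c. Only the diagonal terms survive. *)
rewrite (bigD1 a)//= big1 ?addr0 => [|c ca]; last first.
  rewrite meanZ; last exact: has_moments_edges.
  have ac : (a == c) = false by rewrite eq_sym (negbTE ca).
  have abc : (a == b) && (b == c) = false.
    by apply/negbTE/negP => /andP[/eqP <-]; rewrite ac.
  by rewrite (@mean_edges_eq0 _ (a, b)) ?mulr0//= /same_edge /= !eqxx ac abc.
rewrite meanZ; last exact: has_moments_edges.
by rewrite ler_wpM2l -?expr2 ?sqr_ge0// (@mean_edges_le _ K2).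
Qed.

Definition walk (t : 'I_N * 'I_N * 'I_N * 'I_N * 'I_N * 'I_N) :=
  let: (a, b, c, e, d, g) := t in walk_edges a b c d e g.

Lemma cube_frobeniusE w : cube_frobenius (W w) =
  \sum_t \prod_(q <- walk t) W w q.1 q.2.
Proof.
pose F (t : 'I_N * 'I_N * 'I_N * 'I_N * 'I_N * 'I_N) :=
  \prod_(q <- walk t) W w q.1 q.2.
transitivity (\sum_a \sum_b \sum_c \sum_e \sum_d \sum_g F (a, b, c, e, d, g)).
  rewrite /cube_frobenius; apply: eq_bigr => a _; apply: eq_bigr => b _.
  have -> : (W w *m W w *m W w) a b = \sum_c \sum_e W w a c * W w c e * W w e b.
    rewrite -mulmxA mxE; apply: eq_bigr => c _; rewrite [X in _ * X]mxE mulr_sumr.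
    by apply: eq_bigr => e _; rewrite mulrA.
  rewrite expr2 big_distrlr /=; apply: eq_bigr => c _; apply: eq_bigr => e _.
  rewrite big_distrlr /=; apply: eq_bigr => ? _; apply: eq_bigr => ? _.
  by rewrite /F /= !big_cons big_nil /= mulr1 !mulrA.
rewrite !pair_bigA /=; apply: eq_bigr => -[[[[[a b] c] e] dd] g] _ //.
Qed.

Lemma has_moments_cube : has_moments P (fun w => cube_frobenius (W w)).
Proof.
under eq_fun do rewrite cube_frobeniusE.
by apply: has_moments_sum => t _; exact: has_moments_edges.
Qed.

Lemma mean_cube_le (K6 : R) : 0 <= K6 ->
  (forall j l : 'I_N, (j <= l)%N -> \int[P]_x (`|X j l x| ^+ 6) <= K6) ->
  \int[P]_x cube_frobenius (W x) <= 6 * K6 * 4 ^+ 6 * N%:R ^+ 4.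
Proof.
move=> K6_ge0 X6.
under eq_Rintegral => x _ do rewrite cube_frobeniusE.
rewrite mean_sum => [|t _]; last exact: has_moments_edges.
apply: (@le_trans _ _ (\sum_(t | six_no_single_edge t) 6 * K6)).
  rewrite [leRHS]big_mkcond/=; apply: ler_sum => -[[[[[a b] c] e] dd] g] _.
  have [h|] := boolP (six_no_single_edge _).
    exact: mean_edges_le.
  move=> /allPn[p _ /negPn/eqP ps]; rewrite (mean_edges_eq0 ps)//.
rewrite sumr_const -[_ *+ #|_|]mulr_natr -[leRHS]mulrA ler_wpM2l ?mulr_ge0//.
by rewrite -!natrX -natrM ler_nat card_no_single_edge.
Qed.

End WignerMoments.

(** * Gram matrices and the spiked model *)

Section GramMatrix.
Variable R : realType.

Lemma nth_eigenvalueE n (U : 'M[R]_n) (d : 'rV[R]_n) (i : 'I_n) :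
  U *m U^T = 1%:M -> (forall j l : 'I_n, (j <= l)%N -> d 0 l <= d 0 j) ->
  nth_eigenvalue (U^T *m diag_mx d *m U) i = d 0 i.
Proof.
move=> UU ds; rewrite /nth_eigenvalue eigenvaluesE//.
  by rewrite (nth_map i) ?size_enum_ord// nth_ord_enum.
have : sorted (relpre val leq) (enum 'I_n).
  by rewrite -sorted_map val_enum_ord iota_sorted.
move=> H.
have sub : subrel (relpre val leq)
    (relpre (fun j : 'I_n => d 0 j) (>=%R : rel R)).
  by move=> j l; exact: ds.
by have := sub_sorted sub H; rewrite -sorted_map.
Qed.

Lemma nth_eigenvalueZ n (S : 'M[R]_n) (c : R) (i : 'I_n) : S^T = S -> 0 <= c ->
  nth_eigenvalue (c *: S) i = c * nth_eigenvalue S i.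
Proof.
move=> symS c0; have [U [UU SE le_eig]] := spectral_nth_eigenvalue symS.
set d := \row_i _ in SE.
have -> : c *: S = U^T *m diag_mx (c *: d) *m U.
  by rewrite SE linearZ/= -scalemxAr -scalemxAl.
rewrite nth_eigenvalueE//; first by rewrite !mxE.
by move=> j l jl; rewrite !mxE ler_wpM2l// le_eig// jl ltn_ord.
Qed.

Lemma nth_eigenvalue_diag n (d : 'rV[R]_n) (i : 'I_n) :
  (forall j l : 'I_n, (j <= l)%N -> d 0 l <= d 0 j) ->
  nth_eigenvalue (diag_mx d) i = d 0 i.
Proof.
move=> ds; rewrite -(@nth_eigenvalueE _ 1%:M d)//; last by rewrite trmx1 mulmx1.
by rewrite trmx1 mulmx1 mul1mx.
Qed.

(** By AM-GM each |u_j u_l| is at most (u_j^2 + u_l^2) / 2. The factor [n] is harmless, because the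
    matrices compared this way have the fixed size k. *)
Lemma quad_entries_le n (H : 'M[R]_n) (b : R) (u : 'rV[R]_n) :
  (forall j l, `|H j l| <= b) ->
  `|(u *m H *m u^T) 0 0| <= n%:R * b * (u *m u^T) 0 0.
Proof.
move=> Hb; rewrite dot_rvE.
have -> : \sum_l (u *m H) 0 l * u 0 l = \sum_l \sum_j u 0 j * H j l * u 0 l.
  by apply: eq_bigr => l _; rewrite mxE mulr_suml.
have uu : (u *m u^T) 0 0 = \sum_j u 0 j ^+ 2.
  by rewrite dot_rvE; apply: eq_bigr => j _; rewrite expr2.
have -> : n%:R * b * (u *m u^T) 0 0 =
    \sum_(l < n) \sum_(j < n) b * ((u 0 j ^+ 2 + u 0 l ^+ 2) / 2).
  under eq_bigr do
    rewrite -mulr_sumr -mulr_suml big_split/= -uu sumr_const card_ord.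
  rewrite -mulr_sumr -mulr_suml big_split/= sumrMnl -uu sumr_const card_ord.
  by rewrite -mulr_natl; field.
apply: le_trans (ler_norm_sum _ _ _) _; apply: ler_sum => l _.
apply: le_trans (ler_norm_sum _ _ _) _; apply: ler_sum => j _.
rewrite !normrM mulrAC mulrC; apply: ler_pM => //.
have := sqr_ge0 (`|u 0 j| - `|u 0 l|).
rewrite -[u 0 j ^+ 2]real_normK ?num_real// -[u 0 l ^+ 2]real_normK ?num_real//.
by move: `|u 0 j| `|u 0 l| => x y; rewrite sqrrB; lra.
Qed.

Lemma nth_eigenvalue_entries n (S S' : 'M[R]_n) (b : R) (i : 'I_n) :
  S^T = S -> S'^T = S' -> (forall j l, `|S j l - S' j l| <= b) ->
  `|nth_eigenvalue S i - nth_eigenvalue S' i| <= n%:R * b.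
Proof.
move=> symS symS' SS'.
have h (u : 'rV[R]_n) : `|(u *m S *m u^T) 0 0 - (u *m S' *m u^T) 0 0| <=
    n%:R * b * (u *m u^T) 0 0.
  have -> : (u *m S *m u^T) 0 0 - (u *m S' *m u^T) 0 0 =
      (u *m (S - S') *m u^T) 0 0.
    by rewrite mulmxBr mulmxBl [in RHS]mxE [X in _ = _ + X]mxE.
  by apply: quad_entries_le => j l; rewrite !mxE.
rewrite ler_distl; apply/andP; split.
  rewrite lerBlDr; apply: nth_eigenvalue_dist => // u.
  by have := h u; rewrite ler_distl lerBlDr => /andP[].
apply: nth_eigenvalue_dist => // u.
by have := h u; rewrite ler_distl => /andP[].
Qed.

(** Singular value decomposition of [E]: with [U] diagonalizing [G], the rows of [U *m E] are
    orthogonal with squared norms the eigenvalues of [G], and [D] normalizes them. Rows that are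
    only asymptotically orthonormal are thus replaced by orthonormal ones without any error. *)
Lemma gram_decomposition k n (E : 'M[R]_(k, n)) (G := E *m E^T) :
  (forall j : 'I_k, 0 < nth_eigenvalue G j) ->
  exists2 V : 'M[R]_(k, n), V *m V^T = 1%:M &
    E^T *m E = V^T *m diag_mx (\row_j nth_eigenvalue G j) *m V.
Proof.
move=> G0.
have symG : G^T = G by rewrite /G trmx_mul trmxK.
have [U [UU GE _]] := spectral_nth_eigenvalue symG.
set m := \row_j _ in GE *.
have mE j : m 0 j = Num.sqrt (m 0 j) ^+ 2 by rewrite sqr_sqrtr// mxE ltW.
have s0 j : Num.sqrt (m 0 j) != 0 by rewrite gt_eqF// sqrtr_gt0 mxE.
pose D := diag_mx (\row_j (Num.sqrt (m 0 j))^-1).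
have DD : D *m diag_mx m *m D = 1%:M.
  rewrite !mulmx_diag; apply/matrixP => a b; rewrite !mxE.
  case: eqP => // _; rewrite !mulr1n; have := mE a; have := s0 a; rewrite mxE.
  by move: (Num.sqrt _) => x x0 ->; field.
exists (D *m U *m E).
  rewrite !trmx_mul /D tr_diag_mx -/D !mulmxA -(mulmxA _ E) -/G GE !mulmxA.
  by rewrite -(mulmxA D U) UU mulmx1 -(mulmxA _ U) UU mulmx1.
have -> : (D *m U *m E)^T *m diag_mx m *m (D *m U *m E) =
    E^T *m U^T *m (D *m diag_mx m *m D) *m U *m E.
  by rewrite !trmx_mul /D tr_diag_mx -/D !mulmxA.
by rewrite DD mulmx1 -(mulmxA E^T) (mulmx1C UU) mulmx1.
Qed.

Lemma positive_lower_bound (I : finType) (F : I -> R) : (forall i, 0 < F i) ->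
  exists2 c, 0 < c & forall i, c <= F i.
Proof.
move=> F0; exists (\big[Num.min/1]_i F i).
  by apply: lt_bigmin => // i _; exact: F0.
by move=> i; exact: bigmin_le_cond.
Qed.

End GramMatrix.

(** * Both eigenvalues compared with the spike at a fixed size *)

Section FixedSize.
Context d (T : measurableType d) (R : realType) (P : probability T R).
Variables (k N : nat) (alpha : 'I_k -> R) (h : 'I_k -> R -> R) (theta gamma : R).
Variables (X : 'I_N -> 'I_N -> {RV P >-> R}) (K2 K6 : R) (i : 'I_k).
Notation upper := [set p : 'I_N * 'I_N | (p.1 <= p.2)%N]%SET.
Hypothesis indepX : mutually_independent upper (fun p => X p.1 p.2).
Hypothesis momX : forall j l : 'I_N, (j <= l)%N -> has_moments P (X j l).
Hypothesis meanX : forall j l : 'I_N, (j <= l)%N -> \int[P]_x X j l x = 0.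
Hypothesis X2 : forall j l : 'I_N, (j <= l)%N -> \int[P]_x (`|X j l x| ^+ 2) <= K2.
Hypothesis X6 : forall j l : 'I_N, (j <= l)%N -> \int[P]_x (`|X j l x| ^+ 6) <= K6.
Hypothesis K2_ge0 : 0 <= K2.
Hypothesis K6_ge0 : 0 <= K6.
Hypothesis theta_gt0 : 0 < theta.
Hypothesis gamma_gt0 : 0 < gamma.
Hypothesis alpha_gt0 : forall j, 0 < alpha j.

Notation W := (fun w => Wigner (fun j l => X j l w)).

Definition scaled_spikes : 'M[R]_(k, N) :=
  \matrix_(j, l) (Num.sqrt (alpha j) * discretize N (h j) l 0).

Definition gram : 'M[R]_k := scaled_spikes *m scaled_spikes^T.

Notation mu := (nth_eigenvalue gram).

Hypothesis mu_gap : forall j : 'I_k,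
  [/\ gamma <= mu j, (j < i)%N -> mu i + gamma <= mu j &
      (i < j)%N -> mu j <= mu i - gamma].

Lemma gramE j l : gram j l =
  Num.sqrt (alpha j * alpha l) * dotv (discretize N (h j)) (discretize N (h l)).
Proof.
rewrite /gram /dotv !mxE mulr_sumr; apply: eq_bigr => c _; rewrite !mxE.
by rewrite sqrtrM ?ltW//; ring.
Qed.

Lemma tr_gram : gram^T = gram.
Proof. by rewrite /gram trmx_mul trmxK. Qed.

Lemma spikedE (M : 'M[R]_N) : spiked alpha h theta M =
  theta *: (scaled_spikes^T *m scaled_spikes) + M.
Proof.
rewrite /spiked addrC; congr (_ *: _ + _); apply/matrixP => a b.
rewrite summxE mxE; apply: eq_bigr => j _.
rewrite [LHS]mxE [X in _ * X]mxE big_ord1 !mxE.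
have : alpha j = Num.sqrt (alpha j) ^+ 2 by rewrite sqr_sqrtr// ltW.
by move: (Num.sqrt (alpha j)) => s ->; ring.
Qed.

(** The vector [v] is built from the spikes alone and is therefore deterministic, so the first-order
    term has mean zero in both envelopes [low] and [upp]; only the mean of [E] remains. *)
Lemma spiked_mean :
  exists2 e, 'E_P[fun w => nth_eigenvalue (spiked alpha h theta (W w)) i]%E = e%:E &
    `|e - theta * mu i| <= 2 * (N%:R * (2 * K2)) / (theta * gamma) +
      2 * (4 ^+ 5 * (6 * K6 * 4 ^+ 6 * N%:R ^+ 4) / (theta * gamma) ^+ 5).
Proof.
have [|V VV EE] := @gram_decomposition _ _ _ scaled_spikes.
  by move=> j; have [gj _ _] := mu_gap j; exact: lt_le_trans gj.
pose m : 'rV[R]_k := theta *: \row_j mu j.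
pose v := row i V; pose g := theta * gamma.
have g0 : 0 < g by rewrite mulr_gt0.
have v1 : (v *m v^T) 0 0 = 1.
  transitivity ((V *m V^T) i i); last by rewrite VV mxE eqxx.
  by rewrite !mxE; apply: eq_bigr => j _; rewrite !mxE.
have mj j : m 0 j = theta * mu j by rewrite !mxE.
have AE w : spiked alpha h theta (W w) = V^T *m diag_mx m *m V + W w.
  by rewrite spikedE EE /m linearZ/= -scalemxAr -scalemxAl.
pose E w := 2 * (v *m W w *m (v *m W w)^T) 0 0 / g
  + 2 * (4 ^+ 5 * cube_frobenius (W w) / g ^+ 5).
have EE' w : E w = 2 / g * (v *m W w *m (v *m W w)^T) 0 0 +
    2 * 4 ^+ 5 / g ^+ 5 * cube_frobenius (W w).
  by rewrite /E; field; rewrite gt_eqF.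
have msq := has_moments_sq momX v; have mcube := has_moments_cube momX.
have mE : has_moments P E.
  rewrite (_ : E = fun w => 2 / g * (v *m W w *m (v *m W w)^T) 0 0 +
    2 * 4 ^+ 5 / g ^+ 5 * cube_frobenius (W w)); last exact/funext.
  by apply: has_momentsD; exact: has_momentsZ.
have mq := has_moments_quad momX v.
have pert w : `|nth_eigenvalue (spiked alpha h theta (W w)) i
    - (theta * mu i + (v *m W w *m v^T) 0 0)| <= E w.
  have := @eigenvalue_perturbation _ _ _ V m (W w) i g VV.
  rewrite -AE !mj -/v; apply => //.
  - exact: tr_Wigner.
  - by have [gj _ _] := mu_gap i; rewrite /g ler_wpM2l// ltW.
  - move=> j ji; have [_ /(_ ji) gj _] := mu_gap j.
    by rewrite !mj -mulrDr ler_wpM2l// ltW.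
  - move=> j ij; have [_ _ /(_ ij) gj] := mu_gap j.
    by rewrite !mj -mulrBr ler_wpM2l// ltW.
pose low w := theta * mu i + ((v *m W w *m v^T) 0 0 + -1 * E w).
pose upp w := theta * mu i + ((v *m W w *m v^T) 0 0 + E w).
have mlow : has_moments P low.
  apply: has_momentsD; first exact: has_moments_cst.
  by apply: has_momentsD => //; exact: has_momentsZ.
have mupp : has_moments P upp.
  apply: has_momentsD; first exact: has_moments_cst.
  exact: has_momentsD.
have [|e eE lue] := expectation_between (f := fun w =>
    nth_eigenvalue (spiked alpha h theta (W w)) i) mlow mupp.
  by move=> w; move: (pert w); rewrite ler_distl /low /upp mulN1r !addrA.
exists e => //.
have meanE : \int[P]_x E x <= 2 * (N%:R * (2 * K2)) / g +
      2 * (4 ^+ 5 * (6 * K6 * 4 ^+ 6 * N%:R ^+ 4) / g ^+ 5).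
  under eq_Rintegral => x _ do rewrite EE'.
  rewrite meanD ?meanZ//; try exact: has_momentsZ.
  have := mean_sq_le indepX momX meanX v X2; rewrite v1 mulr1 => h2.
  have h6 := mean_cube_le indepX momX meanX K6_ge0 X6.
  apply: lerD.
    by rewrite mulrAC ler_wpM2r ?invr_ge0 ?(ltW g0)// ler_wpM2l.
  set Y := 6 * K6 * _ * _.
  have -> : 2 * (4 ^+ 5 * Y / g ^+ 5) = 2 * 4 ^+ 5 / g ^+ 5 * Y by ring.
  apply: ler_wpM2l h6; apply: divr_ge0; first by rewrite mulr_ge0 ?exprn_ge0.
  by rewrite exprn_ge0 ?ltW.
have mqE : \int[P]_x ((v *m W x *m v^T) 0 0) = 0 := mean_quad indepX momX meanX v.
have lowE : \int[P]_x low x = theta * mu i - \int[P]_x E x.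
  have mE' := has_momentsZ (-1) mE.
  rewrite /low (meanD (has_moments_cst P _) (has_momentsD mq mE')).
  by rewrite (meanD mq mE') (meanZ _ mE) mqE mean_cst add0r mulN1r.
have uppE : \int[P]_x upp x = theta * mu i + \int[P]_x E x.
  rewrite /upp (meanD (has_moments_cst P _) (has_momentsD mq mE)).
  by rewrite (meanD mq mE) mqE mean_cst add0r.
by apply: le_trans meanE; rewrite ler_distl -lowE -uppE.
Qed.

(** By symmetry of [W] the integrand is the dot product of e_j'W and e_l'W; Cauchy-Schwarz and AM-GM
    reduce it to the diagonal case of [mean_sq_le]. *)
Lemma cross_moment_le j l C :
  dotv (discretize N (h j)) (discretize N (h j)) <= C ->
  dotv (discretize N (h l)) (discretize N (h l)) <= C ->
  `|fine 'E_P[fun w => dotv (discretize N (h j))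
      (W w *m W w *m discretize N (h l))]%E| <= N%:R * (2 * K2) * C.
Proof.
pose v a := (discretize N (h a))^T.
have dv a : dotv (discretize N (h a)) (discretize N (h a)) = (v a *m (v a)^T) 0 0.
  by rewrite /dotv /v trmxK.
rewrite !dv => jC lC.
have dE w : dotv (discretize N (h j)) (W w *m W w *m discretize N (h l)) =
    ((v j *m W w) *m (v l *m W w)^T) 0 0.
  by rewrite /dotv /v trmx_mul trmxK tr_Wigner !mulmxA.
have sE w : ((v j *m W w) *m (v l *m W w)^T) 0 0 = \sum_b \sum_a \sum_c
    (v j 0 a * v l 0 c) * (W w a b * W w c b).
  rewrite dot_rvE; apply: eq_bigr => b _; rewrite !mxE big_distrlr /=.
  by apply: eq_bigr => a _; apply: eq_bigr => c _; ring.
have mW := has_moments_Wigner momX.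
have mf : has_moments P (fun w => dotv (discretize N (h j))
    (W w *m W w *m discretize N (h l))).
  under eq_fun do rewrite dE sE.
  do 3 (apply: has_moments_sum => ? _); apply: has_momentsZ.
  by apply: has_momentsM; exact: mW.
rewrite expectationE//=.
pose g w := (v j *m W w *m (v j *m W w)^T) 0 0.
pose g' w := (v l *m W w *m (v l *m W w)^T) 0 0.
have mg : has_moments P g := has_moments_sq momX (v j).
have mg' : has_moments P g' := has_moments_sq momX (v l).
have le2 w : `|dotv (discretize N (h j)) (W w *m W w *m discretize N (h l))| <=
    2^-1 * (g w + g' w).
  rewrite dE; apply: le_trans (normr_dot_le _ _) _.
  rewrite /g /g' -!sqr_rvnorm.
  have := sqr_ge0 (rvnorm (v j *m W w) - rvnorm (v l *m W w)).
  by move: (rvnorm _) (rvnorm _) => x y; rewrite sqrrB; lra.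
have mh : has_moments P (fun w => 2^-1 * (g w + g' w)).
  by apply: has_momentsZ; exact: has_momentsD.
apply: le_trans (le_normr_Rintegral _ _) _ => //.
  exact: has_moments_integrable.
apply: (@le_trans _ _ (\int[P]_x (2^-1 * (g x + g' x)))).
  apply: le_Rintegral => //.
  - exact/integrable_norm/has_moments_integrable.
  - exact: has_moments_integrable.
rewrite meanZ ?meanD//; last exact: has_momentsD.
have h1 := mean_sq_le indepX momX meanX (v j) X2.
have h2 := mean_sq_le indepX momX meanX (v l) X2.
have K0 : 0 <= N%:R * (2 * K2) by rewrite !mulr_ge0.
have := ler_wpM2l K0 jC; have := ler_wpM2l K0 lC.
rewrite -/(g _) in h1 *; move: h1 h2; rewrite -/g -/g'.
by move: (Rintegral _ _ _) (Rintegral _ _ _) => x y; lra.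
Qed.

Lemma Bmatrix_eigenvalue a :
  (forall j, dotv (discretize N (h j)) (discretize N (h j)) <= 2) ->
  (forall j, alpha j <= a) ->
  `|nth_eigenvalue (Bmatrix P alpha h theta W i) i - theta * mu i| <=
    k%:R * (a * (N%:R * (2 * K2) * 2) / (theta * alpha i ^+ 2)).
Proof.
move=> h2 ha.
have a0 : 0 <= a := le_trans (ltW (alpha_gt0 i)) (ha i).
rewrite -(nth_eigenvalueZ _ tr_gram (ltW theta_gt0)).
apply: nth_eigenvalue_entries.
- apply/matrixP => j l; rewrite !mxE (mulrC (alpha l)).
  congr (_ * _ + _ * fine _ / _).
    by rewrite /dotv !mxE; apply: eq_bigr => c _; rewrite !mxE mulrC.
  congr expectation; apply/funext => w.
  transitivity
    (((discretize N (h l))^T *m (W w *m W w *m discretize N (h j)))^T 0 0).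
    by rewrite mxE.
  by rewrite !trmx_mul !trmxK !tr_Wigner /dotv !mulmxA.
- by rewrite linearZ/= tr_gram.
- move=> j l; rewrite [X in `|X - _|]mxE [X in `|_ - X|]mxE gramE.
  set s := Num.sqrt _; set D := dotv (discretize N (h j)) (discretize N (h l)).
  set F := fine _.
  have -> : s * theta * D + s * F / (theta * alpha i ^+ 2) - theta * (s * D) =
      s * F / (theta * alpha i ^+ 2) by ring.
  rewrite !normrM.
  have sa : `|s| <= a.
    rewrite ger0_norm ?sqrtr_ge0// -(ger0_norm a0) -sqrtr_sqr.
    by rewrite ler_wsqrtr// expr2 ler_pM// ltW.
  have q0 : 0 <= (theta * alpha i ^+ 2)^-1.
    by rewrite invr_ge0 mulr_ge0 ?exprn_ge0 ?ltW.
  rewrite (ger0_norm q0).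
  rewrite ler_wpM2r//.
  by apply: ler_pM => //; exact: cross_moment_le.
Qed.

End FixedSize.

(** * From additive to relative error, and the limit in N *)

(** Here [x] is N, [t] is theta, [e] and [lB] are the two quantities to compare, and [m] is theta
    mu_i. With u = x^2 / t^3, the bound t <= c x gives x / t <= c u t, and u <= 1 gives x^4 / t^5 =
    u (u t) <= u t. All errors are thus of order u t, while [lB] >= g t because it stays within g t
    of m >= 2 g t. *)
Lemma ratio_bound (R : realFieldType) (x t g c eta e lB m c1 c2 c3 : R) :
  0 < x -> 0 < t -> 0 < g -> 0 < c -> 0 <= c1 -> 0 <= c2 -> 0 <= c3 ->
  t <= c * x -> x ^+ 2 <= eta * t ^+ 3 -> eta <= 1 -> c3 * c * eta <= g ->
  2 * g * t <= m ->
  `|e - m| <= c1 * (x / t) + c2 * (x ^+ 4 / t ^+ 5) ->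
  `|lB - m| <= c3 * (x / t) ->
  0 < lB /\
  `|e / lB - 1| <= ((c1 + c3) * c + c2) / g * (x ^+ 2 / t ^+ 3).
Proof.
move=> x0 t0 g0 c0 c10 c20 c30 tx xt eta1 c3g tm em lm.
pose u := x ^+ 2 / t ^+ 3.
have u0 : 0 <= u by rewrite divr_ge0 ?exprn_ge0// ltW.
have ueta : u <= eta by rewrite /u ler_pdivrMr ?exprn_gt0.
have xt1 : x / t <= c * u * t.
  rewrite -subr_ge0; have -> : c * u * t - x / t = (c * x - t) * (x / t ^+ 2).
    by rewrite /u; field; rewrite gt_eqF.
  by rewrite mulr_ge0 ?subr_ge0// divr_ge0 ?exprn_ge0// ltW.
have xt4 : x ^+ 4 / t ^+ 5 <= u * t.
  have -> : x ^+ 4 / t ^+ 5 = u * (u * t) by rewrite /u; field; rewrite gt_eqF.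
  rewrite -[leRHS]mul1r; apply: ler_wpM2r (le_trans ueta eta1).
  exact: mulr_ge0 u0 (ltW t0).
have uE : x ^+ 2 / t ^+ 3 = u by []; clearbody u; rewrite uE.
have lBm : `|lB - m| <= g * t.
  apply: (le_trans lm); apply: (@le_trans _ _ (c3 * (c * u * t))).
    exact: ler_wpM2l.
  rewrite !mulrA ler_wpM2r ?(ltW t0)//; apply: le_trans c3g.
  by rewrite ler_wpM2l// mulr_ge0// ltW.
have lB_ge : g * t <= lB by move: lBm; rewrite ler_distl => /andP[]; lra.
have gt0 : 0 < g * t by rewrite mulr_gt0.
have lB0 : 0 < lB by exact: lt_le_trans lB_ge.
split=> //.
have -> : e / lB - 1 = (e - lB) / lB by field; rewrite gt_eqF.
rewrite normrM [X in _ * X]ger0_norm ?invr_ge0 ?(ltW lB0)// ler_pdivrMr//.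
have elB : `|e - lB| <= ((c1 + c3) * c + c2) * (u * t).
  have -> : e - lB = (e - m) - (lB - m) by ring.
  apply: (le_trans (ler_normB _ _)); apply: (le_trans (lerD em lm)).
  have h1 : c1 * (x / t) <= c1 * (c * u * t) by exact: ler_wpM2l.
  have h3 : c3 * (x / t) <= c3 * (c * u * t) by exact: ler_wpM2l.
  have h2 : c2 * (x ^+ 4 / t ^+ 5) <= c2 * (u * t) by exact: ler_wpM2l.
  have -> : ((c1 + c3) * c + c2) * (u * t) =
    c1 * (c * u * t) + c2 * (u * t) + c3 * (c * u * t) by ring.
  by rewrite lerD// lerD.
apply: (le_trans elB).
have -> : ((c1 + c3) * c + c2) * (u * t) =
    ((c1 + c3) * c + c2) / g * u * (g * t) by field; rewrite gt_eqF.
apply: ler_wpM2l => //; rewrite mulr_ge0// divr_ge0 ?(ltW g0)//.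
by rewrite addr_ge0// mulr_ge0 ?addr_ge0// ltW.
Qed.

Lemma has_moments_of_bound d (T : measurableType d) (R : realType)
    (P : probability T R) (X : {RV P >-> R}) (K : nat -> R) :
  (forall m, (1 <= m)%N ->
     ('E_P[fun w => (`|X w| ^+ m)%R] <= (K m)%:E)%E) ->
  has_moments P X.
Proof.
move=> XK; have mX : measurable_fun setT X by [].
split=> // -[|m].
  have -> : (fun x => `|X x| ^+ 0) = cst 1 by apply/funext.
  exact: finite_measure_integrable_cst.
have mXm : measurable_fun setT (fun x => `|X x| ^+ m.+1).
  by apply: measurable_funX; exact: measurableT_comp.
apply/integrableP; split; first exact/measurable_EFinP.
apply: (@le_lt_trans _ _ 'E_P[fun w => (`|X w| ^+ m.+1)%R]%E).
  rewrite unlock; apply: le_integral_lower => x /=.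
  by rewrite ger0_norm// exprn_ge0.
by apply: le_lt_trans (XK m.+1 _) _; rewrite ?ltry.
Qed.

Lemma powR_two_thirds (R : realType) (n : nat) :
  (n%:R `^ (2 / 3) : R) ^+ 3 = n%:R ^+ 2.
Proof.
rewrite -powR_mulrn ?powR_ge0// -powRrM -powR_mulrn//; congr (_ `^ _).
by field.
Qed.

Theorem theorem2p2 (R : realType) (k : nat) (hk : (1 <= k)%N)
  (alpha : 'I_k -> R)
  (alpha_gt0 : forall i, 0 < alpha i)
  (alpha_decr : forall i j : 'I_k, (i < j)%N -> alpha j < alpha i)
  (B : R) (B_gt0 : 0 < B)
  (f : R -> R -> R)
  (f_ge0 : forall x y, x \in `[0, 1] -> y \in `[0, 1] -> 0 <= f x y)
  (f_bounded : exists M : R,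
     forall x y, x \in `[0, 1] -> y \in `[0, 1] -> `|f x y| <= M)
  (f_integrable : Riemann_integrable2 f)
  (d : nat -> measure_display) (T : forall N : nat, measurableType (d N))
  (P : forall N : nat, probability (T N) R)
  (X : forall N : nat, 'I_N -> 'I_N -> {RV (P N) >-> R})
  (X_indep : forall N : nat,
     mutually_independent [set p : 'I_N * 'I_N | (p.1 <= p.2)%N]%SET
       (fun p => X N p.1 p.2))
  (X_mean : forall (N : nat) (j l : 'I_N), (j <= l)%N ->
     ('E_(P N)[X N j l] = 0)%E)
  (X_var : forall (N : nat) (j l : 'I_N), (j <= l)%N ->
     ('V_(P N)[X N j l] = (f (grid R j) (grid R l))%:E)%E)
  (X_moment : forall (N : nat) (j l : 'I_N) (m : nat), (j <= l)%N -> (1 <= m)%N ->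
     ('E_(P N)[fun w => (`|X N j l w| ^+ m)%R] <= (m%:R `^ (B * m%:R))%:E)%E)
  (h : 'I_k -> R -> R)
  (h_measurable : forall i,
     measurable_fun (`[0, 1] : set (lebesgue_type R)) (h i))
  (h_bounded : forall i, exists M : R, forall x, x \in `[0, 1] -> `|h i x| <= M)
  (h_orthonormal : forall i j, L2inner (h i) (h j) = (i == j)%:R)
  (h_asymptotic : forall i j,
     dotv (discretize N (h i)) (discretize N (h j)) @[N --> \oo]
       --> L2inner (h i) (h j))
  (theta : nat -> R)
  (theta_gt0 : forall N : nat, (0 < N)%N -> 0 < theta N)
  (theta_lower : exists xi : R, Num.max (4 * (B + 1)) 8 < xi /\
     (fun N : nat => Num.sqrt N%:R * (ln N%:R) `^ xi : R) =O_\oo theta)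
  (theta_upper : theta =O_\oo (fun N : nat => N%:R : R))
  (theta_lower2 : (fun N : nat => N%:R `^ (2 / 3) : R) =o_\oo theta)
  (i : 'I_k) :
  let W N (w : T N) := Wigner (fun j l => X N j l w) in
  exists r : nat -> R,
    r =O_\oo (fun N : nat => N%:R ^+ 2 / theta N ^+ 3 : R) /\
    \forall N \near \oo,
      'E_(P N)[fun w => nth_eigenvalue (spiked alpha h (theta N) (W N w)) i]%E
      = (nth_eigenvalue (Bmatrix (P N) alpha h (theta N) (W N) i) i
         * (1 + r N))%:E.
Proof.
move=> W.
pose K m : R := m%:R `^ (B * m%:R).
have momX N (j l : 'I_N) : (j <= l)%N -> has_moments (P N) (X N j l).
  by move=> jl; apply: (@has_moments_of_bound _ _ _ _ _ K) => m; exact: X_moment.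
have meanX N (j l : 'I_N) : (j <= l)%N -> \int[P N]_x X N j l x = 0.
  by move=> jl; have := X_mean N j l jl; rewrite (expectationE (momX N j l jl)) => -[].
have XK N m (j l : 'I_N) : (0 < m)%N -> (j <= l)%N ->
    \int[P N]_x (`|X N j l x| ^+ m) <= K m.
  move=> m0 jl; rewrite -lee_fin -expectationE; first exact: X_moment.
  apply: has_momentsX; apply: has_moments_le (momX N j l jl) _ => [|x].
    by apply: measurableT_comp.
  by rewrite normr_id.
have K_ge0 m : 0 <= K m by exact: powR_ge0.
(* One constant below all the spikes and all the distances between them; the diagonal pairs account
   for the distance of each alpha_j to the eigenvalue zero. *)
have [c c_gt0 alpha_gap] : exists2 c, 0 < c &
    forall p : 'I_k * 'I_k, c <= (if p.1 == p.2 then alpha p.1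
                                 else `|alpha p.1 - alpha p.2|).
  apply: positive_lower_bound => -[j l] /=; case: eqVneq => // jl.
  rewrite normr_gt0 subr_eq0; move: jl; rewrite -val_eqE /= neq_ltn.
  by move=> /orP[] /alpha_decr jl; [rewrite gt_eqF|rewrite lt_eqF].
(* Each mu_j will lie within gamma of alpha_j, so a gap of 3 gamma shrinks by at most 2 gamma and
   gamma is left. *)
pose gamma := c / 3; have gamma_gt0 : 0 < gamma by rewrite divr_gt0.
have cE : c = 3 * gamma by rewrite /gamma; field.
pose a := \sum_j alpha j.
have alpha_le j : alpha j <= a.
  by rewrite /a (bigD1 j)//= lerDl sumr_ge0// => l _; exact: ltW.
have a_ge0 : 0 <= a := le_trans (ltW (alpha_gt0 i)) (alpha_le i).
(* Small enough that k a eps <= gamma, for the eigenvalues of the Gram matrix, and that eps <= 1,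
   for |e_j|^2 <= 2. *)
pose eps := gamma / (k%:R * a + gamma).
have den_gt0 : 0 < k%:R * a + gamma by rewrite ltr_wpDl// mulr_ge0.
have eps_gt0 : 0 < eps by rewrite divr_gt0.
have eps_le1 : eps <= 1 by rewrite ler_pdivrMr// mul1r lerDr mulr_ge0.
have eps_gamma : k%:R * (a * eps) <= gamma.
  rewrite mulrA /eps mulrA ler_pdivrMr// mulrC ler_wpM2l ?(ltW gamma_gt0)//.
  by rewrite lerDl ltW.
move/eqO_exP: theta_upper => [C C_gt0 theta_le].
pose c1 := 4 * K 2 / gamma.
pose c2 := 2 * 4 ^+ 5 * (6 * K 6 * 4 ^+ 6) / gamma ^+ 5.
pose c3 := k%:R * (a * 4 * K 2) / alpha i ^+ 2.
have c1_ge0 : 0 <= c1 by apply: divr_ge0; rewrite ?mulr_ge0 ?K_ge0// ltW.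
have c2_ge0 : 0 <= c2.
  by apply: divr_ge0; rewrite ?mulr_ge0 ?exprn_ge0 ?K_ge0// ltW.
have c3_ge0 : 0 <= c3.
  by apply: divr_ge0; rewrite ?mulr_ge0 ?exprn_ge0 ?K_ge0// ltW.
(* The same device as for [eps]: eta <= 1 and c3 C eta <= gamma are the two smallness conditions of
   [ratio_bound]. *)
pose eta := gamma / (c3 * C + gamma).
have den2_gt0 : 0 < c3 * C + gamma by rewrite ltr_wpDl// mulr_ge0// ltW.
have eta_gt0 : 0 < eta by rewrite divr_gt0.
have eta_le1 : eta <= 1 by rewrite ler_pdivrMr// mul1r lerDr mulr_ge0// ltW.
have eta_gamma : c3 * C * eta <= gamma.
  rewrite /eta mulrA ler_pdivrMr// mulrC ler_wpM2l ?(ltW gamma_gt0)//.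
  by rewrite lerDl ltW.
have theta_ge : \forall N \near \oo, `|N%:R `^ (2 / 3) : R| <= eta * `|theta N|.
  by move/eqoP: theta_lower2; apply.
have dot_near : \forall N \near \oo, forall p : 'I_k * 'I_k,
    `|(p.1 == p.2)%:R - dotv (discretize N (h p.1)) (discretize N (h p.2))| <= eps.
  apply: filter_forall => -[j l] /=; rewrite -h_orthonormal.
  by move/cvgrPdist_le: (h_asymptotic j l); apply.
pose lB N := nth_eigenvalue (Bmatrix (P N) alpha h (theta N) (W N) i) i.
pose EA N := 'E_(P N)[fun w => nth_eigenvalue (spiked alpha h (theta N) (W N w)) i]%E.
(* The exact relative error. For large N the expectation is finite and [lB N] is positive, so
   neither [fine] nor the division takes a junk value there. *)
pose r N := fine (EA N) / lB N - 1.
have key : \forall N \near \oo, [/\ EA N = (lB N * (1 + r N))%:E &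
    `|r N| <= ((c1 + c3) * C + c2) / gamma * `|N%:R ^+ 2 / theta N ^+ 3|].
  near=> N.
  have N0 : (0 < N)%N by near: N; exact: nbhs_infty_gt.
  have t0 := theta_gt0 N N0; have x0 : 0 < N%:R :> R by rewrite ltr0n.
  have tC : theta N <= C * N%:R.
    rewrite -[leLHS]ger0_norm ?(ltW t0)// -[N%:R]ger0_norm//.
    by near: N.
  have xt : N%:R ^+ 2 <= eta * theta N ^+ 3.
    rewrite -powR_two_thirds.
    have : (N%:R `^ (2 / 3) : R) <= eta * theta N.
      rewrite -[leLHS]ger0_norm ?powR_ge0// -[theta N]ger0_norm ?(ltW t0)//.
      by near: N.
    (* Cubing gives N^2 <= eta^3 theta^3, and eta^3 <= eta because eta <= 1. *)
    move=> le_eta; apply: (@le_trans _ _ ((eta * theta N) ^+ 3)).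
      by rewrite lerXn2r// nnegrE ?powR_ge0// mulr_ge0// ltW.
    rewrite exprMn ler_wpM2r ?exprn_ge0 ?(ltW t0)//.
    by rewrite -[leRHS]expr1 ler_wiXn2l// ltW.
  have dotN : forall p : 'I_k * 'I_k, `|(p.1 == p.2)%:R -
      dotv (discretize N (h p.1)) (discretize N (h p.2))| <= eps by near: N.
  pose mu j := nth_eigenvalue (gram N alpha h) j.
  (* The Gram matrix is entrywise within a eps of the diagonal matrix of the alpha_j, whose
     eigenvalues are already in decreasing order. *)
  have mu_alpha (j : 'I_k) : `|mu j - alpha j| <= gamma.
    have <- : nth_eigenvalue (diag_mx (\row_l alpha l)) j = alpha j.
      rewrite nth_eigenvalue_diag ?mxE// => l l'; rewrite !mxE leq_eqVlt.
      by move=> /orP[/eqP/val_inj->//|/alpha_decr/ltW].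
    apply: le_trans eps_gamma; apply: nth_eigenvalue_entries.
    - exact: tr_gram.
    - exact: tr_diag_mx.
    - move=> l l'; rewrite gramE// !mxE.
      have -> : alpha l *+ (l == l') = Num.sqrt (alpha l * alpha l') * (l == l')%:R.
        case: eqVneq => [<-|_]; last by rewrite mulr0.
        by rewrite mulr1 -expr2 sqrtr_sqr ger0_norm// ltW.
      rewrite -mulrBr normrM ler_pM//; last first.
        by rewrite distrC; exact: (dotN (l, l')).
      rewrite ger0_norm ?sqrtr_ge0// -(ger0_norm a_ge0) -sqrtr_sqr.
      by rewrite ler_wsqrtr// expr2 ler_pM// ltW.
  have mu_gap (j : 'I_k) : [/\ gamma <= mu j, (j < i)%N -> mu i + gamma <= mu j &
      (i < j)%N -> mu j <= mu i - gamma].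
    have := mu_alpha j; have := mu_alpha i; rewrite !ler_distl.
    move=> /andP[i1 i2] /andP[j1 j2].
    have := alpha_gap (j, j); rewrite /= eqxx cE => aj.
    have := alpha_gap (j, i); rewrite /= cE.
    case: eqVneq => [ji _|ji aji]; first by rewrite -ji ltnn; split => //; lra.
    split; first by lra.
      move=> /alpha_decr ai; move: aji; rewrite ger0_norm; last first.
        by rewrite subr_ge0 ltW.
      by lra.
    by move=> /alpha_decr ai; move: aji; rewrite ltr0_norm ?subr_lt0//; lra.
  have dot_le2 (j : 'I_k) : dotv (discretize N (h j)) (discretize N (h j)) <= 2.
    have := dotN (j, j); rewrite /= eqxx distrC ler_distl => /andP[_].
    by move=> /le_trans; apply; rewrite -[leRHS]/(1 + 1) lerD2l.
  have [e eE e_mu] := spiked_mean (X_indep N) (momX N) (meanX N)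
    (fun j l => XK N 2 j l isT) (fun j l => XK N 6 j l isT) (K_ge0 6) t0 gamma_gt0
    alpha_gt0 mu_gap.
  have em : `|e - theta N * mu i| <=
      c1 * (N%:R / theta N) + c2 * (N%:R ^+ 4 / theta N ^+ 5).
    apply: (le_trans e_mu); rewrite le_eqVlt; apply/orP; left; apply/eqP.
    by rewrite /c1 /c2; field; rewrite !gt_eqF.
  have B_mu := Bmatrix_eigenvalue i (X_indep N) (momX N) (meanX N)
    (fun j l => XK N 2 j l isT) (K_ge0 2) t0 alpha_gt0 dot_le2 alpha_le.
  have lm : `|lB N - theta N * mu i| <= c3 * (N%:R / theta N).
    apply: (le_trans B_mu); rewrite le_eqVlt; apply/orP; left; apply/eqP.
    by rewrite /c3; field; rewrite !gt_eqF.
  have mu_ge : 2 * gamma * theta N <= theta N * mu i.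
    rewrite mulrC ler_wpM2l ?(ltW t0)//.
    have := mu_alpha i; rewrite ler_distl => /andP[i1 _].
    by have := alpha_gap (i, i); rewrite /= eqxx cE; lra.
  have [lB0 rB] := @ratio_bound R N%:R (theta N) gamma C eta e (lB N)
    (theta N * mu i) c1 c2 c3 x0 t0 gamma_gt0 C_gt0 c1_ge0 c2_ge0 c3_ge0
    tC xt eta_le1 eta_gamma mu_ge em lm.
  have EAE : EA N = e%:E by exact: eE.
  split.
    by rewrite /r EAE /=; congr (_%:E); field; rewrite gt_eqF.
  by rewrite /r EAE /= [in leRHS]ger0_norm// divr_ge0 ?exprn_ge0 ?(ltW t0).
exists r; split.
  (* The added [1] makes the constant strictly positive, since [c1], [c2] and [c3] are only known to
     be nonnegative. *)
  apply/eqO_exP; exists (((c1 + c3) * C + c2) / gamma + 1).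
    rewrite ltr_wpDl// divr_ge0 ?(ltW gamma_gt0)// addr_ge0// mulr_ge0 ?(ltW C_gt0)//.
    exact: addr_ge0.
  apply: filterS key => N [_ rN]; apply: le_trans rN _.
  by rewrite ler_wpM2r// lerDl.
by apply: filterS key => N [].
Unshelve. all: by end_near.
Qed.
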